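(* Let $\tau$, $\chi_0$, the affine toric $3$-fold $X$, and the polyhedra $\Delta_0=\tau\cap[\chi_0=1]$, $\Delta_\infty=\tau\cap[\chi_0=-1]$ be as in the context. If $\chi=a\chi_0$ (resp. $\chi=-a\chi_0$), where $a\in\mathbb N$, $a\ge2$, then $\dim T^1_{-\chi}(X)$ equals the number of bounded edges $E$ of $\Delta_0$ (resp. of $\Delta_\infty$) whose lattice length satisfies $a\le|E|$.
   Context: $\widetilde N$ is a lattice of rank $3$, $\widetilde M$ its dual lattice, $\tau\subset\widetilde N_{\mathbb Q}$ a pointed full-dimensional polyhedral cone, $\tau^\vee\subset\widetilde M_{\mathbb Q}$ its dual, and $X=\mathrm{Spec}\,\mathbb C[\tau^\vee\cap\widetilde M]$ the corresponding affine toric variety. $\chi_0\in\widetilde M$ is a primitive vector taking both positive and negative values on $\tau$, such that whenever a one-dimensional face of $\tau$ intersects one of the planes $[\chi_0=1]$, $[\chi_0=-1]$, the intersection point is a lattice point. $\Delta_0$ and $\Delta_\infty$ are the two-dimensional polyhedra $\tau\cap[\chi_0=1]$ and $\tau\cap[\chi_0=-1]$ (in the paper, projected isomorphically to $N_{\mathbb Q}=\ker\chi_0$ along a complementary line $N'$, which does not affect lattice lengths); their bounded edges are the intersections with these planes of those facets of $\tau$ both of whose edges are positive (resp. negative) with respect to $\chi_0$. The lattice length $|E|$ of a lattice segment $E$ is the number of lattice points on it including exactly one of its endpoints. $T^1(X)$ is the space of first order infinitesimal deformations: writing $\mathbb C[X]=\mathbb C[\check x_1,\dots,\check x_n]/I$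 with homogeneous generators, $T^1(X)$ is the cokernel of $\mathrm{Der}\,\mathbb C[\check x_1,\dots,\check x_n]\to\mathrm{Hom}_{\mathbb C[X]}(I/I^2,\mathbb C[X])$, $\sum g_i\partial/\partial\check x_i\mapsto(g\mapsto\sum g_i\partial g/\partial\check x_i\bmod I)$; it is $\widetilde M$-graded (with $\deg\partial/\partial\check x_i=-\deg\check x_i$), and $T^1_\lambda(X)$ is its graded component of degree $\lambda\in\widetilde M$. *)

(* Defs.v *)
From HB Require Import structures.
From mathcomp Require Import all_boot all_order all_algebra.
From mathcomp Require Import finmap.
From mathcomp Require Import boolp classical_sets functions cardinality reals.
From mathcomp Require Import complex.
From mathcomp Require monalg.
From mathcomp Require Import mpoly.
(* The notation {mpoly R[n]} of monalg denotes another type than that of mpoly. *)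
Import -(notations) monalg.
Import mpoly.

Set Implicit Arguments.
Unset Strict Implicit.
Unset Printing Implicit Defensive.

Import Order.TTheory GRing.Theory Num.Theory.

Local Open Scope classical_set_scope.
Local Open Scope card_scope.
Local Open Scope ring_scope.

(* The lattice N~ is Z^3, written as row vectors, and its dual M~ is Z^3,
   written as column vectors; the pairing is the matrix product. *)
Notation NQ := 'rV[rat]_3.
Notation MQ := 'cV[rat]_3.
Notation Mlat := 'cV[int]_3.

Definition pairing (v : NQ) (u : MQ) : rat := (v *m u) 0 0.

Definition toMQ (m : Mlat) : MQ := map_mx intr m.

Definition lattice_point (v : NQ) : Prop := v \is a mxOver Num.int.

(* Taking k = 0 shows that the zero vector is not primitive. *)
Definition primitive (m : Mlat) : Prop :=
  forall (k : nat) (m' : Mlat), m = m' *+ k -> k = 1%N.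

Definition cone_of (gens : seq NQ) : set NQ :=
  [set v | exists c : 'I_(size gens) -> rat,
     (forall i, 0 <= c i) /\ v = \sum_i c i *: gens`_i].

Record polycone := Polycone {
  gens : seq NQ;
  polycone_full : <<gens>>%VS = fullv;
  polycone_pointed :
    forall v, cone_of gens v -> cone_of gens (- v) -> v = 0 }.

Definition cone (tau : polycone) : set NQ := cone_of (gens tau).

Definition dual_lattice (tau : polycone) : pred Mlat :=
  fun m => `[< forall v, cone tau v -> 0 <= pairing v (toMQ m) >].

(* Faces of a polyhedron, cut out by supporting affine hyperplanes
   (u = 0, c = 0 gives the polyhedron itself). *)
Definition face (P F : set NQ) : Prop :=
  exists (u : MQ) (c : rat), (forall v, P v -> c <= pairing v u) /\
    F = [set v | P v /\ pairing v u = c].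

Definition one_dimensional (F : set NQ) : Prop :=
  exists p q, [/\ F p, F q, p != q &
    forall v, F v -> exists t : rat, v = p + t *: (q - p)].

Definition edge (P E : set NQ) : Prop := face P E /\ one_dimensional E.

Definition bounded_set (F : set NQ) : Prop :=
  exists B : rat, forall v, F v -> forall i, `|v 0 i| <= B.

Definition segment (p q : NQ) : set NQ :=
  [set v | exists t : rat, 0 <= t <= 1 /\ v = (1 - t) *: p + t *: q].

Definition lattice_length (E : set NQ) (l : nat) : Prop :=
  exists p q, E = segment p q /\
    [set v | [/\ E v, v != q & lattice_point v]] #= `I_l.

Definition slice (tau : polycone) (chi0 : Mlat) (c : rat) : set NQ :=
  [set v | cone tau v /\ pairing v (toMQ chi0) = c].

Definition long_bounded_edges (P : set NQ) (a : nat) : set (set NQ) :=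
  [set E | [/\ edge P E, bounded_set E &
    exists l, lattice_length E l /\ (a <= l)%N]].

(* The semigroup of lattice points of the dual cone, written
   multiplicatively as required by [conomType]. *)
Definition dual_semigroup (tau : polycone) : predArgType :=
  {m : Mlat | dual_lattice tau m}.

Section DualSemigroup.
Variable tau : polycone.
Implicit Types x y : dual_semigroup tau.

HB.instance Definition _ := Choice.on (dual_semigroup tau).

Lemma pairingD v (m m' : Mlat) :
  pairing v (toMQ (m + m')) = pairing v (toMQ m) + pairing v (toMQ m').
Proof. by rewrite /pairing /toMQ map_mxD mulmxDr mxE. Qed.

Lemma pairing0 v : pairing v (toMQ 0) = 0.
Proof. by rewrite /pairing /toMQ map_mx0 mulmx0 mxE. Qed.

Lemma dual_lattice0 : dual_lattice tau 0.
Proof. by apply/asboolP => v _; rewrite pairing0. Qed.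

Lemma dual_latticeD m m' :
  dual_lattice tau m -> dual_lattice tau m' -> dual_lattice tau (m + m').
Proof.
move=> /asboolP hm /asboolP hm'; apply/asboolP => v hv.
by rewrite pairingD addr_ge0 ?hm ?hm'.
Qed.

Lemma gens_cone v : v \in gens tau -> cone tau v.
Proof.
move=> vg; have lt : (index v (gens tau) < size (gens tau))%N by rewrite index_mem.
exists (fun i => (i == Ordinal lt)%:R); split; first by move=> i; rewrite ler0n.
rewrite (bigD1 (Ordinal lt)) //= eqxx scale1r big1 ?addr0 ?nth_index //.
by move=> i /negbTE ->; rewrite scale0r.
Qed.

Lemma pairing_gens_eq0 (m : Mlat) :
  (forall v, v \in gens tau -> pairing v (toMQ m) = 0) -> m = 0.
Proof.
move=> h.
have hall v : pairing v (toMQ m) = 0.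
  have : v \in <<gens tau>>%VS by rewrite polycone_full memvf.
  rewrite -[gens tau]in_tupleE => /coord_span ->.
  rewrite /pairing mulmx_suml summxE big1 // => i _.
  rewrite -scalemxAl mxE.
  have := h (in_tuple (gens tau))`_i; rewrite /pairing => ->; first by rewrite mulr0.
  by rewrite mem_nth.
apply/matrixP => i j; rewrite ord1 mxE.
have := hall (delta_mx 0 i); rewrite /pairing -rowE !mxE.
by move/eqP; rewrite intr_eq0 => /eqP.
Qed.

Definition dual_one : dual_semigroup tau := exist _ 0 dual_lattice0.

Definition dual_mul x y : dual_semigroup tau :=
  exist _ (val x + val y) (dual_latticeD (valP x) (valP y)).

Lemma dual_mulA : associative dual_mul.
Proof. by move=> x y z; apply: val_inj; rewrite /= addrA. Qed.

Lemma dual_mulC : commutative dual_mul.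
Proof. by move=> x y; apply: val_inj; rewrite /= addrC. Qed.

Lemma dual_mul1m : left_id dual_one dual_mul.
Proof. by move=> x; apply: val_inj; rewrite /= add0r. Qed.

Lemma dual_mulm1 : right_id dual_one dual_mul.
Proof. by move=> x; apply: val_inj; rewrite /= addr0. Qed.

Lemma dual_unitm x y : dual_mul x y = dual_one -> x = dual_one /\ y = dual_one.
Proof.
move=> /(congr1 val) /= xy0.
have key : forall v, v \in gens tau ->
  pairing v (toMQ (val x)) = 0 /\ pairing v (toMQ (val y)) = 0.
  move=> v /gens_cone hv.
  have /asboolP/(_ v hv) hx := valP x; have /asboolP/(_ v hv) hy := valP y.
  have /eqP := pairingD v (val x) (val y).
  rewrite xy0 pairing0 eq_sym paddr_eq0 // => /andP[/eqP ? /eqP ?]; by [].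
by split; apply: val_inj; apply: pairing_gens_eq0 => v /key [].
Qed.

HB.instance Definition _ := Choice_isMonomialDef.Build (dual_semigroup tau)
  dual_mulA dual_mul1m dual_mulm1 dual_unitm.
HB.instance Definition _ :=
  MonomialDef_isConomialDef.Build (dual_semigroup tau) dual_mulC.

End DualSemigroup.

Definition coord_ring (K : fieldType) (tau : polycone) : comAlgType K :=
  malg (dual_semigroup tau) K.

Definition ring_homog (K : fieldType) (tau : polycone) (mu : Mlat)
    (f : malg (dual_semigroup tau) K) : Prop :=
  forall s, s \in monalg.msupp f -> val s = mu.

Definition poly_homog (K : fieldType) (n : nat) (deg : 'I_n -> Mlat)
    (mu : Mlat) (p : {mpoly K[n]}) : Prop :=
  forall m, m \in msupp p -> \sum_i deg i *+ m i = mu.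

Definition eval_alg (K : fieldType) (A : comAlgType K) (n : nat)
    (x : 'I_n -> A) (p : {mpoly K[n]}) : A :=
  mmap (fun c => c%:A) x p.

(* Homogeneous generators x_1, ..., x_n of C[X], i.e. a graded presentation
   C[X] = C[x_1, ..., x_n] / I. *)
Record presentation (K : fieldType) (tau : polycone) := Presentation {
  nvars : nat;
  gen : 'I_nvars -> coord_ring K tau;
  gdeg : 'I_nvars -> Mlat;
  gen_homog : forall i, ring_homog (gdeg i) (gen i);
  gen_surj : forall f, exists p, eval_alg gen p = f }.

Section T1.
Variables (K : fieldType) (tau : polycone) (X : presentation K tau).

Notation n := (nvars X).
Notation P := {mpoly K[n]}.
Notation A := (coord_ring K tau).
Notation ev := (eval_alg (@gen K tau X)).

Definition in_ideal : pred P := fun p => ev p == 0.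

Definition ideal : predArgType := {p : P | in_ideal p}.

Definition ideal_sq : set P :=
  [set f | exists s : seq (ideal * ideal),
     f = \sum_(q <- s) val q.1 * val q.2].

(* Hom_{C[X]}(I/I^2, C[X]): a map out of I/I^2 is a map on I which is constant
   on the cosets of I^2; C[X] = C[x]/I acts on I/I^2 through representatives. *)
Definition normal_hom : set (ideal -> A) :=
  [set h | (forall f g : ideal, ideal_sq (val f - val g) -> h f = h g) /\
     (forall (p : P) (f g k : ideal),
        val k = p * val f + val g -> h k = ev p * h f + h g)].

Definition hom_degree (lambda : Mlat) : set (ideal -> A) :=
  [set h | forall mu f, poly_homog (@gdeg K tau X) mu (val f) ->
     ring_homog (mu + lambda) (h f)].

Definition derivation_hom : set (ideal -> A) :=
  [set h | exists g : 'I_n -> P,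
     forall f : ideal, h f = ev (\sum_i g i * (val f)^`M(i))].

End T1.

Arguments normal_hom {K tau} X.
Arguments hom_degree {K tau} X lambda.
Arguments derivation_hom {K tau} X.

(* [quotient_dim H D d]: the image of H in V/D, for subspaces H and D of V,
   has a basis with d elements. *)
Definition quotient_dim (K : fieldType) (V : lmodType K) (H D : set V)
    (d : nat) : Prop :=
  exists e : 'I_d -> V, (forall i, H (e i)) /\
    forall h, H h -> exists! c : 'rV[K]_d, D (h - \sum_i c 0 i *: e i).

(* T^1_lambda(X) is the image in T^1(X) = coker(Der -> Hom) of the
   homomorphisms of degree lambda. *)
Definition dim_T1 (K : fieldType) (tau : polycone) (X : presentation K tau)
    (lambda : Mlat) (d : nat) : Prop :=
  quotient_dim (normal_hom X `&` hom_degree X lambda)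
    (derivation_hom X) d.

(* Main.v *)
Require Import Defs.
From HB Require Import structures.
From mathcomp Require Import all_boot all_order all_algebra.
From mathcomp Require Import finmap.
From mathcomp Require Import boolp classical_sets functions cardinality reals.
From mathcomp Require Import complex.
From mathcomp Require monalg.
From mathcomp Require Import mpoly ring zify lra.
Import -(notations) monalg.
Import mpoly.

Set Implicit Arguments.
Unset Strict Implicit.
Unset Printing Implicit Defensive.

Import Order.TTheory GRing.Theory Num.Theory.

Local Open Scope classical_set_scope.
Local Open Scope card_scope.
Local Open Scope ring_scope.

(* Let S be the monoid of lattice points of the dual cone and R = a chi0. A normal
   homomorphism of degree -R becomes, after multiplication by a monomial, a
   derivation chi^s |-> G(s) chi^(s - R), because X is smooth along its torus; this
   identifies T^1_(-R) with the space of functions G on S \ (R + S) such that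
   G(s + t) = G(s) + G(t) whenever s + t is not in R + S, modulo restrictions of
   additive functions.
   Let v_0, ..., v_k be the vertices of Delta_0, ordered along its boundary. They
   are primitive generators of rays of tau, and S \ (R + S) is the union of the sets
   S_i = {s | <v_i, s> < a}. As a >= 2, G is additive on each S_i, say G = l_i there.
   Moving along a tail direction of Delta_0 shows that S_i and S_j meet inside S_m
   for i < m < j, so only the conditions l_i = l_(i+1) on S_i and S_(i+1) remain;
   these two sets meet in a spanning set if the edge [v_i, v_(i+1)] is shorter than a,
   and in a set spanning the orthogonal of its direction otherwise. *)

(** * The monoid algebra, graded by the lattice *)

(** The generators of the algebra are only homogeneous: each is [coef i] times a character, where
    [coef i] may vanish and [gdeg i] may then lie outside [S]. Most case distinctions on [coef] come
    from this. A polynomial evaluating to $\chi^s$ is called a lift of $s$. Two lifts $p$, $q$ of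
    $s$ differ by an element of $I$, and $h(p - q)$ is a cocycle on lifts. It is a coboundary:
    comparing $p$ with a quotient of lifts that is multiplicative in $s \in \widetilde M$ gives a
    potential $V$, additive on products of lifts. The values of $V$ on standard lifts form $G$; its
    values on the variables give the derivation to be subtracted. The factor $\chi^{p_0}$ lies so
    deep in the dual cone that no denominators remain. The order of the vertices comes from a
    nonzero $c \in \tau$ with $\langle c, \chi_0\rangle = 0$, which exists because $\chi_0$ changes
    sign on $\tau$: the projection of $\Delta_0$ along $c$ to a line is injective on vertices. The
    jumps $l_i - l_{i+1}$ across long edges are free scalar multiples of the edge direction, and
    they are the coordinates on $T^1$. *)

Lemma malg1M (K : fieldType) (G : conomType) (s t : G) :
  monalg.mkmalgU s 1 * monalg.mkmalgU t 1 =
  monalg.mkmalgU (monalg.mul s t) 1 :> malg G K.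
Proof. by rewrite monalg.malgM_def monalg.fgmulUU mulr1. Qed.

Lemma malgUE (K : fieldType) (G : conomType) (s : G) (c : K) :
  monalg.mkmalgU s c = c *: monalg.mkmalgU s 1 :> malg G K.
Proof.
apply/monalg.malgP => t.
by rewrite monalg.mcoeffZ !monalg.mcoeffU mulrnAr mulr1.
Qed.

Section Coord.
Variables (K : fieldType) (tau : polycone).
Notation A := (coord_ring K tau).
Notation S := (dual_lattice tau).

Definition toS (u : Mlat) : option (dual_semigroup tau) := insub u.

Definition mono (u : Mlat) : A :=
  if toS u is Some s then monalg.mkmalgU s 1 else 0.

Definition coef_at (u : Mlat) (f : A) : K :=
  if toS u is Some s then monalg.mcoeff s f else 0.

Lemma toS_in u (uS : u \in S) : toS u = Some (exist _ u uS).
Proof. by rewrite /toS insubT. Qed.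

Lemma toS_val (s : dual_semigroup tau) : toS (val s) = Some s.
Proof. exact: valK. Qed.

Lemma coef_at_is_linear u : linear (coef_at u : A -> K^o).
Proof.
move=> c f g; rewrite /coef_at; case: toS => [s|]; last by rewrite scaler0 addr0.
by rewrite monalg.mcoeffD monalg.mcoeffZ.
Qed.

Lemma coef_at_inj f g : (forall u, coef_at u f = coef_at u g) -> f = g.
Proof.
move=> fg; apply/monalg.malgP => s; have := fg (val s).
by rewrite /coef_at toS_val.
Qed.

Lemma coef_at_out f u : u \notin S -> coef_at u f = 0.
Proof. by move=> uS; rewrite /coef_at /toS insubN. Qed.

Lemma mono_out u : u \notin S -> mono u = 0.
Proof. by move=> uS; rewrite /mono /toS insubN. Qed.

Lemma coef_at_mono u w : u \in S -> coef_at w (mono u) = (u == w)%:R.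
Proof.
move=> uS; rewrite /mono (toS_in uS).
have [wS|wS] := boolP (w \in S); last first.
  by rewrite coef_at_out //; case: eqP wS => // <-; rewrite uS.
by rewrite /coef_at (toS_in wS) monalg.mcoeffU; congr (_%:R).
Qed.

Lemma mono_mul u w : u \in S -> w \in S -> mono u * mono w = mono (u + w).
Proof.
move=> uS wS; have uwS : u + w \in S by apply: dual_latticeD.
rewrite /mono (toS_in uS) (toS_in wS) (toS_in uwS).
have <- : dual_mul (exist _ u uS) (exist _ w wS) = exist _ (u + w) uwS.
  exact: val_inj.
exact: malg1M.
Qed.

Lemma mono0 : mono 0 = 1.
Proof.
rewrite /mono (toS_in (dual_lattice0 tau)).
by congr monalg.mkmalgU; apply: val_inj.
Qed.

Lemma coef_at_ind (P : A -> Prop) :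
  P 0 -> (forall f g, P f -> P g -> P (f + g)) ->
  (forall c u, u \in S -> P (c *: mono u)) -> forall f, P f.
Proof.
move=> P0 PD PM f; rewrite [f]monalg.monalgE.
elim/big_rec: _ => [//|s g _ Pg]; apply: PD => //.
have := PM (monalg.mcoeff s f) (val s) (valP s).
by rewrite /mono toS_val (malgUE s (monalg.mcoeff s f)).
Qed.

End Coord.

(* [chi] and [co] are extended by [0] outside [S], so that degrees can be shifted
   freely in the whole lattice. *)
Record monoid_alg (K : fieldType) (S : pred Mlat) := MonoidAlg {
  carrier : comAlgType K;
  chi : Mlat -> carrier;
  co : Mlat -> carrier -> K;
  monoid0 : 0 \in S;
  monoidD : forall u w, u \in S -> w \in S -> u + w \in S;
  chi0E : chi 0 = 1;
  chiM : forall u w, u \in S -> w \in S -> chi u * chi w = chi (u + w);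
  chi_out : forall u, u \notin S -> chi u = 0;
  co_is_linear : forall u, linear (co u : carrier -> K^o);
  co_inj : forall f g, (forall u, co u f = co u g) -> f = g;
  co_out : forall f u, u \notin S -> co u f = 0;
  co_chi : forall u w, u \in S -> co w (chi u) = (u == w)%:R;
  chi_ind : forall P : carrier -> Prop,
    P 0 -> (forall f g, P f -> P g -> P (f + g)) ->
    (forall c u, u \in S -> P (c *: chi u)) -> forall f, P f }.

Arguments chi {K S} m u.
Arguments monoidD {K S} m {u w}.
Arguments monoid0 {K S} m.
Arguments co {K S} m u f.
Arguments co_is_linear {K S} m u.

Definition coord_monoid_alg (K : fieldType) (tau : polycone) :
    monoid_alg K (dual_lattice tau) :=
  @MonoidAlg K (dual_lattice tau) (coord_ring K tau) (@mono K tau) (@coef_at K tau)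
    (dual_lattice0 tau) (fun u w => @dual_latticeD tau u w) (@mono0 K tau)
    (@mono_mul K tau) (@mono_out K tau) (@coef_at_is_linear K tau)
    (@coef_at_inj K tau) (@coef_at_out K tau) (@coef_at_mono K tau) (@coef_at_ind K tau).

HB.instance Definition _ K S (B : monoid_alg K S) u :=
  GRing.isLinear.Build K (carrier B) K^o *:%R (co B u) (co_is_linear B u).

Section MonoidAlg.
Variables (K : fieldType) (S : pred Mlat) (B : monoid_alg K S).
Notation A := (carrier B).
Notation chi := (chi B).
Notation co := (co B).

Lemma coB u f g : co u (f - g) = co u f - co u g. Proof. exact: linearB. Qed.
Lemma coD u f g : co u (f + g) = co u f + co u g. Proof. exact: linearD. Qed.
Lemma co0 u : co u 0 = 0. Proof. exact: linear0. Qed.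
Lemma coZ u c f : co u (c *: f) = c * co u f. Proof. exact: linearZ. Qed.
Lemma co_sum u I (r : seq I) (F : I -> A) :
  co u (\sum_(i <- r) F i) = \sum_(i <- r) co u (F i).
Proof. exact: linear_sum. Qed.

Lemma co_chiM u f w : u \in S -> co w (chi u * f) = co (w - u) f.
Proof.
move=> uS; elim/chi_ind: f => [|f g hf hg|c v vS].
- by rewrite mulr0 !co0.
- by rewrite mulrDr !coD hf hg.
rewrite -scalerAr !coZ chiM // !co_chi //; last exact: (monoidD B).
by rewrite [v == _]eq_sym subr_eq eq_sym [v + u]addrC.
Qed.

Lemma chi_lreg u f g : u \in S -> chi u * f = chi u * g -> f = g.
Proof.
move=> uS fg; apply: (@co_inj _ _ B) => w.
by rewrite -[w](addrK u) -!co_chiM // fg.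
Qed.

Definition is_homog mu (f : A) := forall u, u != mu -> co u f = 0.

(** A graded piece is spanned by one character. Outside [S] both sides vanish, because [co] and
    [chi] do. *)
Lemma homog_chi mu f : is_homog mu f -> f = co mu f *: chi mu.
Proof.
move=> fmu; apply: (@co_inj _ _ B) => w.
have [muS|muS] := boolP (mu \in S); last first.
  rewrite chi_out // scaler0 co0.
  by have [->|/fmu //] := eqVneq w mu; rewrite co_out.
rewrite coZ co_chi //.
have [<-|ne] := eqVneq mu w; first by rewrite mulr1.
by rewrite mulr0 fmu // eq_sym.
Qed.
End MonoidAlg.
Arguments co_inj {K S} m {f g}.
Arguments chi_lreg {K S} B {u f g}.

(** * Normal homomorphisms and partially additive functions *)

Ltac lattice := apply/matrixP => ? ?; rewrite !mxE; ring.

(** The value at $s - t$ has to be $g(s) - g(t)$; it is well defined because $s - t = s' - t'$ gives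
    $s + t' = s' + t$. The domain [D] is kept explicit, since on a facet the differences only fill a
    hyperplane. *)
Lemma additive_extension (U V : zmodType) (T : pred U) (g : U -> V) :
  (forall s t, s \in T -> t \in T -> s + t \in T /\ g (s + t) = g s + g t) ->
  let D u := exists s t, [/\ s \in T, t \in T & u = s - t] in
  exists l : U -> V, (forall s, s \in T -> l s = g s) /\
    forall u v, D u -> D v -> l (u + v) = l u + l v.
Proof.
move=> gT D.
have rep u : exists st : U * U, D u -> [/\ st.1 \in T, st.2 \in T & u = st.1 - st.2].
  have [[s [t h]]|nD] := pselect (D u); first by exists (s, t).
  by exists (0, 0).
have [r rP] := choice rep; pose l u := g (r u).1 - g (r u).2.
have lE s t : s \in T -> t \in T -> l (s - t) = g s - g t.
  move=> sT tT; rewrite /l.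
  have := rP (s - t) (ex_intro _ s (ex_intro _ t (And3 sT tT erefl))).
  case: (r _) => a b /= [aT bT e]; apply/eqP.
  rewrite subr_eq addrAC eq_sym subr_eq -(gT _ _ sT bT).2 -(gT _ _ aT tT).2.
  by rewrite -[s](subrK t) e -!addrA [t + _]addrC addKr.
exists l; split=> [s sT|u v [s [t [sT tT ->]]] [s' [t' [s'T t'T ->]]]].
  by have [ssT gss] := gT _ _ sT sT; rewrite -{1}(addrK s s) lE // gss addrK.
have [ssT gss] := gT _ _ sT s'T; have [ttT gtt] := gT _ _ tT t'T.
by rewrite addrACA -opprD !lE // gss gtt opprD addrACA.
Qed.

Definition pospart (z : int) : nat := if z is Posz n then n else 0%N.

Lemma pospartB (z : int) : z = (pospart z)%:Z - (pospart (- z))%:Z.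
Proof. by case: z => [[|n]|n] /=; lia. Qed.

(** Additivity of an integer in terms of its positive and negative parts, written without
    subtraction so that it applies to exponents. *)
Lemma pospartD (a b : int) : (pospart (a + b)%R + pospart (- a) + pospart (- b) =
  pospart (- (a + b)) + pospart a + pospart b)%N.
Proof.
by have := pospartB a; have := pospartB b; have := pospartB (a + b); lia.
Qed.

(** * Monomials, lifts of characters and relations of a graded presentation *)

Section Presentation.
Variables (K : fieldType) (S : pred Mlat) (B : monoid_alg K S).
Notation A := (carrier B).
Notation chi := (chi B).
Notation co := (co B).
Variables (n : nat) (x : 'I_n -> A) (gdeg : 'I_n -> Mlat).
Hypothesis x_homog : forall i, is_homog (gdeg i) (x i).
Hypothesis x_surj : forall f, exists p, eval_alg x p = f.
Notation P := {mpoly K[n]}.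
Notation ev := (eval_alg x).

Lemma evD p q : ev (p + q) = ev p + ev q.
Proof. exact: (rmorphD (mmap (in_alg A) x)). Qed.
Lemma evB p q : ev (p - q) = ev p - ev q.
Proof. exact: (rmorphB (mmap (in_alg A) x)). Qed.
Lemma ev0 : ev 0 = 0. Proof. exact: (rmorph0 (mmap (in_alg A) x)). Qed.
Lemma ev1 : ev 1 = 1. Proof. exact: (rmorph1 (mmap (in_alg A) x)). Qed.
Lemma evM p q : ev (p * q) = ev p * ev q.
Proof. exact: (rmorphM (mmap (in_alg A) x)). Qed.
Lemma evZ c p : ev (c *: p) = c *: ev p.
Proof. exact: etrans (mmapZ x (in_alg A) c p) (mulr_algl _ _). Qed.
Lemma ev_sum I (r : seq I) (F : I -> P) :
  ev (\sum_(i <- r) F i) = \sum_(i <- r) ev (F i).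
Proof. exact: (rmorph_sum (mmap (in_alg A) x)). Qed.

Definition coef i := co (gdeg i) (x i).
Definition coefm (m : 'X_{1..n}) := \prod_i coef i ^+ m i.
Definition degm (m : 'X_{1..n}) := \sum_i gdeg i *+ m i.

Lemma coef_deg i : coef i != 0 -> gdeg i \in S.
Proof. by apply: contra_neqT => /(co_out (x i)). Qed.

Lemma monoidMn u k : u \in S -> u *+ k \in S.
Proof.
move=> uS; elim: k => [|k IH]; first exact: (monoid0 B).
by rewrite mulrS; apply: (monoidD B).
Qed.

Lemma chiXn u k : u \in S -> chi u ^+ k = chi (u *+ k).
Proof.
move=> uS; elim: k => [|k IH]; first by rewrite chi0E.
by rewrite exprS IH chiM ?mulrS ?monoidMn.
Qed.

(** Both claims need one induction: $\chi^u \chi^w = \chi^{u+w}$ requires degrees in [S], which are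
    known only for nonzero coefficients. *)
Lemma ev_monomial m :
  ev 'X_[m] = coefm m *: chi (degm m) /\ (coefm m != 0 -> degm m \in S).
Proof.
rewrite [ev _](mmapX x (in_alg A) m) /mmap1 /coefm /degm.
elim/big_rec3: _ => [|i u f c _ [-> uS]]; first by rewrite chi0E scale1r (monoid0 B).
split=> [|]; last first.
  rewrite mulf_eq0 negb_or expf_eq0 negb_and => /andP[h /uS cS].
  apply: (monoidD B) => //; case/orP: h => [|/coef_deg iS]; last by apply: monoidMn.
  by rewrite -eqn0Ngt => /eqP ->; rewrite mulr0n (monoid0 B).
have [c0|c0] := eqVneq c 0; first by rewrite c0 scale0r !mulr0 scale0r.
have {}uS := uS c0.
rewrite (homog_chi (@x_homog i)) -/(coef i) exprZn -scalerAr -scalerAl.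
rewrite scalerA [c * _]mulrC.
case: (posnP (m i)) => [->|mi].
  by rewrite !expr0 mulr0n add0r !mul1r.
have [ci|/coef_deg iS] := eqVneq (coef i) 0.
  by rewrite ci expr0n eqn0Ngt mi mul0r !scale0r.
by rewrite chiXn // chiM // monoidMn.
Qed.

Lemma coefm_degm m : coefm m != 0 -> degm m \in S.
Proof. by case: (ev_monomial m). Qed.

Lemma ev_expand p :
  ev p = \sum_(m <- msupp p) (p@_m * coefm m) *: chi (degm m).
Proof.
rewrite [p in LHS]mpolyE ev_sum; apply: eq_bigr => m _.
by rewrite evZ (proj1 (ev_monomial m)) scalerA.
Qed.

(** A polynomial evaluating to $\chi^s$ has a term that contributes to degree $s$; its monomial is
    as required. *)
Lemma rep_exists s : s \in S -> exists m, coefm m != 0 /\ degm m = s.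
Proof.
move=> sS; have [p ep] := x_surj (chi s).
have : co s (ev p) != 0 by rewrite ep co_chi // eqxx oner_eq0.
rewrite ev_expand co_sum => nz.
have [m mp hm] : exists2 m, m \in msupp p &
    co s ((p@_m * coefm m) *: chi (degm m)) != 0.
  apply: contrapT => h; case/eqP: nz; rewrite big_seq big1 // => m mp.
  by apply: contrapT => /eqP nz; apply: h; exists m.
have cm : coefm m != 0.
  by apply: contraNneq hm => ->; rewrite mulr0 scale0r co0.
exists m; split=> //; apply: contraNeq hm => hne.
by rewrite coZ co_chi ?coefm_degm // (negbTE hne) mulr0.
Qed.

Definition rep (s : Mlat) : 'X_{1..n} :=
  if pselect (s \in S) is left sS then sval (cid (rep_exists sS)) else 0%MM.

Lemma repP s : s \in S -> coefm (rep s) != 0 /\ degm (rep s) = s.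
Proof.
by move=> sS; rewrite /rep; case: pselect => // h; case: (cid _).
Qed.

Definition unitary m : P := (coefm m)^-1 *: 'X_[m].

Lemma ev_unitary m : coefm m != 0 -> ev (unitary m) = chi (degm m).
Proof.
by move=> cm; rewrite evZ (proj1 (ev_monomial m)) scalerA mulVf // scale1r.
Qed.

Lemma unitary_homog m : poly_homog gdeg (degm m) (unitary m).
Proof. by move=> m' /msuppZ_le; rewrite msuppX inE => /eqP ->. Qed.

Definition std_lift s := unitary (rep s).

Lemma ev_lift s : s \in S -> ev (std_lift s) = chi s.
Proof. by move/repP => [? {2}<-]; rewrite ev_unitary. Qed.

(** For nonzero [coefm m] this is, up to a scalar, a difference of two lifts of the same character;
    otherwise it is the monomial itself, which then lies in the ideal. *)
Definition relator m : P := 'X_[m] - coefm m *: std_lift (degm m).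

Lemma ev_relator m : ev (relator m) = 0.
Proof.
rewrite evB evZ (proj1 (ev_monomial m)).
have [->|/coefm_degm mS] := eqVneq (coefm m) 0; first by rewrite !scale0r subrr.
by rewrite ev_lift // subrr.
Qed.

Lemma relator_unitary m : coefm m != 0 ->
  relator m = coefm m *: (unitary m - std_lift (degm m)).
Proof. by move=> cm; rewrite scalerBr scalerA mulfV // scale1r. Qed.

Lemma relator_homog m : poly_homog gdeg (degm m) (relator m).
Proof.
move=> m' /msuppB_le; rewrite mem_cat => /orP[].
  by rewrite msuppX inE => /eqP ->.
have [->|/coefm_degm mS] := eqVneq (coefm m) 0; first by rewrite scale0r msupp0.
have [_ e] := repP mS.
by move/msuppZ_le/unitary_homog => ->.
Qed.

Lemma relator_span f : ev f = 0 -> f = \sum_(m <- msupp f) f@_m *: relator m.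
Proof.
move=> ef; under eq_bigr do rewrite /relator scalerBr scalerA.
rewrite sumrB -mpolyE.
suff -> : \sum_(m <- msupp f) (f@_m * coefm m) *: std_lift (degm m) = 0.
  by rewrite subr0.
(* After grouping by degree, the coefficient of [std_lift u] is the coefficient of $\chi^u$ in
   [ev f], hence zero. *)
pose us := undup (map degm (msupp f)).
have -> : \sum_(m <- msupp f) (f@_m * coefm m) *: std_lift (degm m) =
    \sum_(m <- msupp f) \sum_(u <- us)
      ((f@_m * coefm m) * (degm m == u)%:R) *: std_lift u.
  rewrite [LHS]big_seq [RHS]big_seq; apply: eq_bigr => m mf.
  rewrite (bigD1_seq (degm m)) ?undup_uniq ?mem_undup ?map_f //=.
  rewrite eqxx mulr1 big1 ?addr0 // => u hu.
  by rewrite eq_sym (negbTE hu) mulr0 scale0r.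
rewrite exchange_big /= big1 // => u _; rewrite -scaler_suml.
suff -> : \sum_(m <- msupp f) f@_m * coefm m * (degm m == u)%:R = 0.
  by rewrite scale0r.
transitivity (co u (ev f)); last by rewrite ef co0.
rewrite ev_expand co_sum; apply: eq_bigr => m _; rewrite coZ.
have [->|/coefm_degm mS] := eqVneq (coefm m) 0; first by rewrite !mulr0 !mul0r.
by rewrite co_chi.
Qed.

Lemma coefmD m m' : coefm (m + m')%MM = coefm m * coefm m'.
Proof.
by rewrite -big_split; apply: eq_bigr => i _; rewrite mnmDE exprD.
Qed.

Lemma degmD m m' : degm (m + m')%MM = degm m + degm m'.
Proof.
by rewrite -big_split; apply: eq_bigr => i _; rewrite mnmDE mulrnDr.
Qed.

Lemma coefmU i : coefm U_(i) = coef i.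
Proof.
rewrite /coefm (bigD1 i) //= mnm1E eqxx expr1 big1 ?mulr1 // => j ji.
by rewrite mnm1E eq_sym (negbTE ji) expr0.
Qed.

Lemma degmU i : degm U_(i) = gdeg i.
Proof.
rewrite /degm (bigD1 i) //= mnm1E eqxx mulr1n big1 ?addr0 // => j ji.
by rewrite mnm1E eq_sym (negbTE ji) mulr0n.
Qed.

Lemma coefm0 : coefm 0%MM = 1.
Proof. by rewrite /coefm big1 // => i _; rewrite mnm0E expr0. Qed.

Lemma degm0 : degm 0%MM = 0.
Proof. by rewrite /degm big1 // => i _; rewrite mnm0E mulr0n. Qed.

Lemma mnm_ind (Q : 'X_{1..n} -> Prop) :
  Q 0%MM -> (forall i m, Q m -> Q (U_(i) + m)%MM) -> forall m, Q m.
Proof.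
move=> Q0 QS m; have [k] := ubnP (mdeg m); elim: k m => // k IH m mk.
have [->//|] := eqVneq m 0%MM; rewrite -mdeg_eq0 mdegE sum_nat_eq0 negb_forall.
case/existsP=> i /= mi; have le : (U_(i) <= m)%MM by rewrite lep1mP.
rewrite -(submK le) addmC; apply: QS; apply: IH.
by move: mk; rewrite -{1}(submK le) mdegD mdeg1 addn1.
Qed.

Definition islift p s := s \in S /\ ev p = chi s.
(** [V] behaves like a logarithm on lifts; the degree is an argument so that it need not be
    recovered from the polynomial. *)
Definition additive_on_lifts (V : P -> Mlat -> K) :=
  forall p s q t, islift p s -> islift q t -> V (p * q) (s + t) = V p s + V q t.

Lemma islift_unitary m : coefm m != 0 -> islift (unitary m) (degm m).
Proof. by move=> cm; split; rewrite ?ev_unitary ?coefm_degm. Qed.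

Lemma islift_lift s : s \in S -> islift (std_lift s) s.
Proof. by move=> sS; split; rewrite ?ev_lift. Qed.

Lemma islift1 : islift 1 0.
Proof. by split; rewrite ?ev1 ?chi0E ?(monoid0 B). Qed.

Lemma isliftM p s q t : islift p s -> islift q t -> islift (p * q) (s + t).
Proof.
by move=> [sS ep] [tS eq]; split; [apply: (monoidD B)|rewrite evM ep eq chiM].
Qed.

Lemma isliftX p s k : islift p s -> islift (p ^+ k) (s *+ k).
Proof.
move=> ps; elim: k => [|k IH]; first by rewrite expr0 mulr0n; apply: islift1.
by rewrite exprS mulrS; apply: isliftM.
Qed.

Lemma additive_on_lifts1 V : additive_on_lifts V -> V 1 0 = 0.
Proof.
move=> aV; have := aV 1 0 1 0 islift1 islift1; rewrite mulr1 addr0.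
by move/eqP; rewrite -subr_eq0 opprD addNKr oppr_eq0 => /eqP.
Qed.

Lemma unitaryD m m' : unitary (m + m')%MM = unitary m * unitary m'.
Proof.
by rewrite /unitary coefmD invfM mpolyXD -scalerAr -scalerAl scalerA mulrC.
Qed.

Definition wt (v : 'I_n -> K) (m : 'X_{1..n}) := \sum_i v i *+ m i.

Lemma wtD v m m' : wt v (m + m')%MM = wt v m + wt v m'.
Proof.
by rewrite -big_split; apply: eq_bigr => i _; rewrite mnmDE mulrnDr.
Qed.

Lemma wtU v i : wt v U_(i) = v i.
Proof.
rewrite /wt (bigD1 i) //= mnm1E eqxx mulr1n big1 ?addr0 // => j ji.
by rewrite mnm1E eq_sym (negbTE ji) mulr0n.
Qed.

Lemma wt0 v : wt v 0%MM = 0.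
Proof. by rewrite /wt big1 // => i _; rewrite mnm0E mulr0n. Qed.

Lemma unitary0 : unitary 0%MM = 1.
Proof. by rewrite /unitary coefm0 invr1 scale1r mpolyX0. Qed.

(** Both sides turn products into sums, so the generators suffice; a zero generator does not divide
    a monomial with nonzero coefficient. *)
Lemma additive_on_lifts_monomial V v m : additive_on_lifts V ->
  (forall i, coef i != 0 -> V (unitary U_(i)) (gdeg i) = v i) ->
  coefm m != 0 -> V (unitary m) (degm m) = wt v m.
Proof.
move=> aV vP; elim/mnm_ind: m => [|i m IH].
  by rewrite wt0 unitary0 degm0 additive_on_lifts1.
rewrite coefmD coefmU mulf_eq0 negb_or => /andP[ci cm].
rewrite unitaryD degmD aV ?IH ?wtD ?wtU ?degmU ?vP //.
  by rewrite -degmU; apply: islift_unitary; rewrite coefmU.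
exact: islift_unitary.
Qed.

(** * Derivations into the algebra and linear maps on the ideal *)

Definition der (g : 'I_n -> A) (f : P) : A := \sum_i g i * ev f^`M(i).

Lemma ev_derivation (g : 'I_n -> P) f :
  ev (\sum_i g i * f^`M(i)) = der (fun i => ev (g i)) f.
Proof. by rewrite ev_sum; apply: eq_bigr => i _; rewrite evM. Qed.

Lemma der_lift (g : 'I_n -> A) : exists g' : 'I_n -> P,
  forall f, ev (\sum_i g' i * f^`M(i)) = der g f.
Proof.
have [g' hg'] := choice (fun i => x_surj (g i)); exists g' => f.
by rewrite ev_derivation; apply: eq_bigr => i _; rewrite hg'.
Qed.

Lemma derD g f f' : der g (f + f') = der g f + der g f'.
Proof.
by rewrite -big_split; apply: eq_bigr => i _; rewrite mderivD evD mulrDr.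
Qed.

Lemma derZ g c f : der g (c *: f) = c *: der g f.
Proof.
by rewrite scaler_sumr; apply: eq_bigr => i _; rewrite mderivZ evZ scalerAr.
Qed.

Lemma derB g f f' : der g (f - f') = der g f - der g f'.
Proof. by rewrite -scaleN1r derD derZ scaleN1r. Qed.

Lemma der0 g : der g 0 = 0.
Proof. by rewrite -(scale0r 0) derZ scale0r. Qed.

Lemma der_sum g I (r : seq I) (F : I -> P) :
  der g (\sum_(i <- r) F i) = \sum_(i <- r) der g (F i).
Proof. exact: (big_morph _ (derD g) (der0 g)). Qed.

Lemma derM g p q : der g (p * q) = ev p * der g q + ev q * der g p.
Proof.
rewrite !mulr_sumr -big_split; apply: eq_bigr => i _ /=.
by rewrite mderivM evD !evM; ring.
Qed.

Lemma derX g i : der g 'X_i = g i.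
Proof.
rewrite /der (bigD1 i) //= mderivX mnm1E eqxx scale1r.
rewrite (_ : (U_(i) - U_(i) = 0)%MM) ?mpolyX0 ?ev1 ?mulr1; last first.
  by apply/mnmP => j; rewrite mnmBE subnn mnm0E.
rewrite big1 ?addr0 // => j ji.
by rewrite mderivX mnm1E eq_sym (negbTE ji) scale0r ev0 mulr0.
Qed.

Lemma is_homogM mu nu (f g : A) : is_homog mu f -> is_homog nu g ->
  is_homog (mu + nu) (f * g).
Proof.
move=> /homog_chi -> /homog_chi -> w hw.
rewrite -scalerAl -scalerAr !coZ.
have [muS|muS] := boolP (mu \in S); last by rewrite chi_out // mul0r co0 !mulr0.
have [nuS|nuS] := boolP (nu \in S); last by rewrite [chi nu]chi_out // mulr0 co0 !mulr0.
by rewrite chiM // co_chi ?(monoidD B) // eq_sym (negbTE hw) !mulr0.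
Qed.

Lemma is_homogD mu (f g : A) : is_homog mu f -> is_homog mu g -> is_homog mu (f + g).
Proof. by move=> hf hg w hw; rewrite coD hf // hg // addr0. Qed.

Lemma is_homogZ mu c (f : A) : is_homog mu f -> is_homog mu (c *: f).
Proof. by move=> hf w hw; rewrite coZ hf // mulr0. Qed.

Lemma is_homog0 mu : is_homog mu (0 : A).
Proof. by move=> w _; rewrite co0. Qed.

Lemma is_homog_chi mu c : is_homog mu (c *: chi mu).
Proof.
apply: is_homogZ => w hw; have [muS|muS] := boolP (mu \in S).
  by rewrite co_chi // eq_sym (negbTE hw).
by rewrite chi_out // co0.
Qed.

Lemma der_homog g (e : Mlat) mu f : (forall i, is_homog (gdeg i + e) (g i)) ->
  poly_homog gdeg mu f -> is_homog (mu + e) (der g f).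
Proof.
move=> gh fh; rewrite [f]mpolyE der_sum big_seq.
elim/big_rec: _ => [|m y /fh <- hy]; first exact: is_homog0.
apply: is_homogD => //; rewrite derZ; apply: is_homogZ => {y hy}.
rewrite -/(degm m); elim/mnm_ind: m => [|i m IH].
  by rewrite mpolyX0 -mpolyC1 /der big1 => [|i _]; [exact: is_homog0|rewrite mderivC ev0 mulr0].
rewrite mpolyXD derM degmD degmU; apply: is_homogD.
  rewrite -addrA; apply: is_homogM IH.
  by rewrite (proj1 (ev_monomial _)) degmU; apply: is_homog_chi.
rewrite derX addrAC [_ + degm m]addrC; apply: is_homogM => //.
by rewrite (proj1 (ev_monomial _)); apply: is_homog_chi.
Qed.

Lemma der_monomial0 g m : (forall i, coef i = 0 -> g i = 0) -> coefm m = 0 ->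
  der g 'X_[m] = 0.
Proof.
move=> g0; elim/mnm_ind: m => [|i m IH]; first by rewrite coefm0 => /eqP; rewrite oner_eq0.
rewrite coefmD coefmU mpolyXD derM derX => /eqP; rewrite mulf_eq0 => /orP[]/eqP h.
  by rewrite (proj1 (ev_monomial _)) coefmU h g0 // scale0r mul0r mulr0 addr0.
by rewrite IH // (proj1 (ev_monomial m)) h scale0r mulr0 mul0r addr0.
Qed.

(** These represent $\mathrm{Hom}(I, A)$ by functions on all polynomials whose values off the ideal
    are arbitrary, which avoids a subtype. Passing to $I/I^2$ adds no condition, as $I$ acts by zero
    on $A$. *)
Definition ideal_linear (h : P -> A) := forall p f g, ev f = 0 -> ev g = 0 ->
  h (p * f + g) = ev p * h f + h g.

Section IdealLinear.
Variable h : P -> A.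
Hypothesis hl : ideal_linear h.

Lemma ideal_linear0 : h 0 = 0.
Proof.
have := @hl 1 0 0 ev0 ev0; rewrite mul1r addr0 ev1 mul1r => /eqP.
by rewrite -subr_eq0 opprD addNKr oppr_eq0 => /eqP.
Qed.

Lemma ideal_linearM p f : ev f = 0 -> h (p * f) = ev p * h f.
Proof. by move=> f0; rewrite -[p * f]addr0 hl ?ev0 // ideal_linear0 addr0. Qed.

Lemma ideal_linearD f g : ev f = 0 -> ev g = 0 -> h (f + g) = h f + h g.
Proof. by move=> f0 g0; rewrite -[f in LHS]mul1r hl // ev1 mul1r. Qed.

Lemma ideal_linearZ c f : ev f = 0 -> h (c *: f) = c *: h f.
Proof.
by move=> f0; rewrite -mul_mpolyC ideal_linearM // -[c%:MP]mulr1 mul_mpolyC evZ ev1 mulr_algl.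
Qed.

Lemma ideal_linear_sum (r : seq 'X_{1..n}) (F : 'X_{1..n} -> P) :
  (forall m, ev (F m) = 0) -> h (\sum_(m <- r) F m) = \sum_(m <- r) h (F m).
Proof.
move=> F0; elim: r => [|m r IH]; first by rewrite !big_nil ideal_linear0.
rewrite !big_cons ideal_linearD ?IH // ev_sum big1 // => i _; exact: F0.
Qed.
End IdealLinear.

Lemma ideal_linear_eq h h' : ideal_linear h -> ideal_linear h' ->
  (forall m, h (relator m) = h' (relator m)) -> forall f, ev f = 0 -> h f = h' f.
Proof.
move=> hl hl' e f /relator_span ->.
have r0 m : ev (f@_m *: relator m) = 0 by rewrite evZ ev_relator scaler0.
rewrite !ideal_linear_sum //; apply: eq_bigr => m _.
by rewrite !ideal_linearZ ?ev_relator ?e.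
Qed.

Lemma der_ideal_linear g : ideal_linear (der g).
Proof. by move=> p f k f0 k0; rewrite derD derM f0 mul0r addr0. Qed.

Lemma ideal_linear_mull a h : ideal_linear h -> ideal_linear (fun f => a * h f).
Proof. by move=> hl p f g f0 g0; rewrite hl //; ring. Qed.

Lemma ideal_linearB h h' : ideal_linear h -> ideal_linear h' ->
  ideal_linear (fun f => h f - h' f).
Proof. by move=> hl hl' p f g f0 g0; rewrite hl // hl' //; ring. Qed.

Variables (R p0 : Mlat).
Hypothesis p0S : p0 \in S.
Hypothesis p0R : p0 - R \in S.
Hypothesis p0_deep : forall i, gdeg i + (p0 - R) \in S.
Hypothesis S_generates : forall u, exists s t, [/\ s \in S, t \in S & u = s - t].

(* Modulo additive functions and functions supported on [R + S], these functions
   form the component of degree [- R] of T^1. *)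
Definition partially_additive (G : Mlat -> K) := forall s t,
  s \in S -> t \in S -> s + t - R \notin S -> G (s + t) = G s + G t.

(* The derivation [chi s |-> G s * chi (s - R)], multiplied by [chi p0] in order to
   have values in the monoid algebra. *)
Definition log_field (G : Mlat -> K) (i : 'I_n) : A :=
  (coef i * G (gdeg i)) *: chi (gdeg i + (p0 - R)).

Definition represents (h : P -> A) (G : Mlat -> K) :=
  forall f, ev f = 0 -> chi p0 * h f = der (log_field G) f.

Lemma log_field_coef0 G i : coef i = 0 -> log_field G i = 0.
Proof. by move=> e; rewrite /log_field e mul0r scale0r. Qed.

(** On lifts of characters the Leibniz rule becomes additivity, as for a logarithmic derivative. *)
Lemma der_coef_additive g e : additive_on_lifts (fun p s => co (s + e) (der g p)).
Proof.
move=> p s q t [sS ep] [tS eq]; rewrite derM ep eq coD !co_chiM //.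
by rewrite addrC; congr (co _ _ + co _ _); rewrite addrAC ?addrK // [s + t]addrC addrK.
Qed.

Lemma der_unitaryU g e i : co (gdeg i + e) (der g (unitary U_(i))) =
  (coef i)^-1 * co (gdeg i + e) (g i).
Proof. by rewrite /unitary coefmU derZ coZ derX. Qed.

Lemma der_log_unitary G m : coefm m != 0 ->
  der (log_field G) (unitary m) =
    wt (G \o gdeg) m *: chi (degm m + (p0 - R)).
Proof.
move=> cm; rewrite [LHS](@homog_chi _ _ _ (degm m + (p0 - R))); last first.
  apply: der_homog (@unitary_homog m) => i; exact: is_homog_chi.
congr (_ *: _).
apply: (additive_on_lifts_monomial (@der_coef_additive _ _)) => // i ci.
by rewrite der_unitaryU coZ co_chi // eqxx mulr1 mulrA mulVf // mul1r.
Qed.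

Lemma der_log_relator G m : der (log_field G) (relator m) =
  (coefm m * (wt (G \o gdeg) m - wt (G \o gdeg) (rep (degm m))))
    *: chi (degm m + (p0 - R)).
Proof.
have [cm|cm] := eqVneq (coefm m) 0.
  rewrite /relator cm !scale0r subr0 mul0r scale0r der_monomial0 // => i.
  exact: log_field_coef0.
have [cr dr] := repP (coefm_degm cm).
rewrite relator_unitary // derZ derB !der_log_unitary // dr -scalerBl scalerA.
by [].
Qed.

(** Generators are split off one at a time. The remaining degree stays outside $R + S$ because $S +
    (R + S) \subset R + S$, so partial additivity applies each time. *)
Lemma wt_partially_additive G m : partially_additive G -> coefm m != 0 ->
  degm m - R \notin S -> wt (G \o gdeg) m = G (degm m).
Proof.
move=> pG; elim/mnm_ind: m => [_|i m IH].
  rewrite degm0 wt0 => h; have := pG 0 0 (monoid0 B) (monoid0 B); rewrite addr0 => /(_ h)/eqP.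
  by rewrite -subr_eq0 opprD addNKr oppr_eq0 => /eqP.
rewrite coefmD coefmU mulf_eq0 negb_or => /andP[/coef_deg iS cm].
rewrite degmD degmU wtD wtU => h; rewrite IH // ?pG ?coefm_degm //.
by apply: contra h => h; rewrite -addrA; apply: (monoidD B).
Qed.

Lemma represents_exists G : partially_additive G -> exists h : P -> A,
  [/\ ideal_linear h, represents h G &
      forall mu f, ev f = 0 -> poly_homog gdeg mu f -> is_homog (mu - R) (h f)].
Proof.
move=> pG.
have kex f : exists k, ev f = 0 -> chi p0 * k = der (log_field G) f.
  have [f0|f0] := eqVneq (ev f) 0; last by exists 0 => h; rewrite h eqxx in f0.
  suff [k hk] : exists k, chi p0 * k =
      \sum_(m <- msupp f) der (log_field G) (f@_m *: relator m).
    by exists k => _; rewrite hk -der_sum -relator_span.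
  elim: (msupp f) => [|m r [k hk]]; first by exists 0; rewrite big_nil mulr0.
  rewrite big_cons -hk derZ der_log_relator.
  (* Division by $\chi^{p_0}$ works relator by relator: either $s - R \in S$ for the degree $s$, and
     $\chi^{s-R}$ is available, or the weights of the two lifts of $s$ both equal $G(s)$ and the
     term vanishes. *)
  have [mS|mS] := boolP (degm m - R \in S).
    exists (f@_m *: ((coefm m * (wt (G \o gdeg) m - wt (G \o gdeg) (rep (degm m))))
       *: chi (degm m - R)) + k).
    rewrite mulrDr; congr (_ + _); rewrite -!scalerAr chiM //.
    by congr (_ *: (_ *: chi _)); lattice.
  exists k; have [->|cm] := eqVneq (coefm m) 0.
    by rewrite mul0r scale0r scaler0 add0r.
  have [cr dr] := repP (coefm_degm cm).
  by rewrite !wt_partially_additive ?dr // subrr mulr0 scale0r scaler0 add0r.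
have [h hP] := choice kex; exists h; split=> //.
  move=> p f g f0 g0; apply: (chi_lreg B p0S).
  rewrite hP ?evD ?evM ?f0 ?g0 ?mulr0 ?addr0 // der_ideal_linear // -!hP //.
  by ring.
move=> mu f f0 fh w hw; have := co_chiM (h f) (p0 + w) p0S.
rewrite [p0 + w]addrC addrK => <-; rewrite hP //.
apply: (der_homog (e := p0 - R) _ fh) => [i|]; first exact: is_homog_chi.
apply: contraNneq hw => e; apply/eqP.
transitivity (w + p0 - p0); [lattice|rewrite e; lattice].
Qed.
(** [W] subtracts the given derivation from the logarithmic field. On a difference of two lifts of
    $s$ both compute $h$, so [W] depends only on $s$ and is additive on $S$; if $s - R \notin S$,
    the subtracted term is zero and [W] equals $G$. *)
Lemma represents_der_additive h G g : represents h G -> partially_additive G ->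
  (forall f, ev f = 0 -> h f = der g f) ->
  exists l : Mlat -> K, (forall u v, l (u + v) = l u + l v) /\
    forall s, s \in S -> s - R \notin S -> G s = l s.
Proof.
move=> hG pG hg.
pose W p s := co (s + (p0 - R)) (der (log_field G) p) - co (s - R) (der g p).
have aW : additive_on_lifts W.
  move=> p s q t ps qt; rewrite /W der_coef_additive //.
  by rewrite [X in _ - X]der_coef_additive //; ring.
have WE p q s : islift p s -> islift q s -> W p s = W q s.
  move=> [sS ep] [_ eq]; have e0 : ev (p - q) = 0 by rewrite evB ep eq subrr.
  have key : co (s + (p0 - R)) (der (log_field G) p - der (log_field G) q) =
      co (s - R) (der g p - der g q).
    rewrite -!derB -hg // -hG // co_chiM //.
    by congr (co _ _); lattice.
  by move: key; rewrite !coB /W => /eqP; rewrite subr_eq => /eqP ->; ring.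
have [s t sS tS|l [lS lD]] := @additive_extension _ K S (fun s => W (std_lift s) s).
  split; first exact: (monoidD B).
  rewrite -aW; try exact: islift_lift.
  by apply: WE; [apply: islift_lift; apply: (monoidD B)|apply: isliftM; apply: islift_lift].
exists l; split=> [u v|s sS sR]; first by apply: lD.
have [cr dr] := repP sS.
rewrite lS // /W (co_out _ sR) subr0 -[in RHS]dr der_log_unitary ?dr // coZ.
by rewrite co_chi ?eqxx ?mulr1 ?wt_partially_additive ?dr // (monoidD B).
Qed.

Lemma represents_additive_der h G l : ideal_linear h -> represents h G ->
  (forall u v, l (u + v) = l u + l v) ->
  (forall s, s \in S -> s - R \notin S -> G s = l s) ->
  exists g : 'I_n -> A, forall f, ev f = 0 -> h f = der g f.
Proof.
move=> hl hG lD Gl.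
(* When [gdeg i - R] is outside [S], [chi] is zero there, in agreement with $G = l$. The field of
   the additive [l] kills every relator, so subtracting it changes nothing on the ideal. *)
pose g i : A := (coef i * (G (gdeg i) - l (gdeg i))) *: chi (gdeg i - R).
have chig i : chi p0 * g i = log_field G i - log_field l i.
  rewrite /g /log_field -scalerAr -scalerBl -mulrBr.
  have [->|/coef_deg iS] := eqVneq (coef i) 0; first by rewrite mul0r !scale0r.
  have [iR|iR] := boolP (gdeg i - R \in S); last first.
    by rewrite Gl // subrr mulr0 !scale0r.
  by rewrite chiM //; congr (_ *: chi _); lattice.
have wtl m : wt (l \o gdeg) m = l (degm m).
  have l0 : l 0 = 0.
    by apply/eqP; rewrite -(subrr (l 0)) -[in X in _ == X - _](addr0 0) lD addrK.
  elim/mnm_ind: m => [|i m IH]; first by rewrite wt0 degm0 l0.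
  by rewrite wtD wtU IH degmD degmU lD.
exists g; apply: ideal_linear_eq => // [|m]; first exact: der_ideal_linear.
apply: (chi_lreg B p0S); rewrite hG ?ev_relator //.
have -> : chi p0 * der g (relator m) =
    der (log_field G) (relator m) - der (log_field l) (relator m).
  rewrite mulr_sumr -sumrB; apply: eq_bigr => i _.
  by rewrite mulrA chig mulrBl.
rewrite [X in _ - X]der_log_relator !wtl.
have [->|cm] := eqVneq (coefm m) 0; first by rewrite mul0r scale0r subr0.
by have [_ ->] := repP (coefm_degm cm); rewrite subrr mulr0 scale0r subr0.
Qed.

(** * Decomposition of a homomorphism into a partially additive function and a derivation *)

Section Decomposition.
Variable h : P -> A.
Hypothesis hl : ideal_linear h.
Hypothesis h_homog : forall mu f,
  ev f = 0 -> poly_homog gdeg mu f -> is_homog (mu - R) (h f).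

(** Linearity of [h], as [ev r] is $\chi^t$. It serves to bring several differences of lifts to a
    common degree. *)
Lemma lift_shift p q r s t : islift p s -> islift q s -> islift r t ->
  co (s + t - R) (h (p * r - q * r)) = co (s - R) (h (p - q)).
Proof.
move=> [sS ep] [_ eq] [tS er]; have e0 : ev (p - q) = 0 by rewrite evB ep eq subrr.
rewrite -mulrBl mulrC ideal_linearM // er co_chiM //; congr (co _ _).
by lattice.
Qed.

Lemma lift_cocycle p q r s : islift p s -> islift q s -> islift r s ->
  co (s - R) (h (p - q)) + co (s - R) (h (q - r)) = co (s - R) (h (p - r)).
Proof.
move=> [_ ep] [_ eq] [_ er].
by rewrite -coD -ideal_linearD ?evB ?ep ?eq ?er ?subrr // addrA subrK.
Qed.

(* Writing the coordinate vectors as differences of elements of [S] yields lifts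
   of [u], up to the lift [QQ u], that are additive in [u] up to a common factor. *)
Lemma difference_of_lifts : exists (PP QQ : Mlat -> P) (dP dQ : Mlat -> Mlat),
  [/\ forall u, islift (PP u) (dP u), forall u, islift (QQ u) (dQ u),
      forall u, u + dQ u = dP u &
      forall u w, PP (u + w) * QQ u * QQ w = QQ (u + w) * PP u * PP w].
Proof.
have [st stP] := choice (fun k : 'I_3 =>
  let: ex_intro s (ex_intro t (And3 a b c)) := S_generates (delta_mx k 0) in
  ex_intro (fun st : Mlat * Mlat => [/\ st.1 \in S, st.2 \in S &
    delta_mx k 0 = st.1 - st.2]) (s, t) (And3 a b c)).
pose E (a b : 'I_3 -> nat) :=
  \prod_k (std_lift (st k).1 ^+ a k * std_lift (st k).2 ^+ b k).
pose dE (a b : 'I_3 -> nat) := \sum_k ((st k).1 *+ a k + (st k).2 *+ b k).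
have EP a b : islift (E a b) (dE a b).
  rewrite /E /dE; elim/big_rec2: _ => [|k d p _ IH]; first exact: islift1.
  have [sS tS _] := stP k.
  by apply: isliftM => //; apply: isliftM; apply: isliftX; apply: islift_lift.
pose pos (u : Mlat) (k : 'I_3) := pospart (u k 0).
pose neg (u : Mlat) (k : 'I_3) := pospart (- u k 0).
exists (fun u => E (pos u) (neg u)), (fun u => E (neg u) (pos u)).
exists (fun u => dE (pos u) (neg u)), (fun u => dE (neg u) (pos u)).
split=> // [u|u w].
  have {1}-> : u = \sum_k (u k 0) *: delta_mx k 0 :> Mlat.
    rewrite {1}[u]matrix_sum_delta; apply: eq_bigr => k _.
    by rewrite big_ord1.
  rewrite -big_split; apply: eq_bigr => k _ /=; have [_ _ ->] := stP k.
  have e : u k 0 = (pos u k)%:Z - (neg u k)%:Z by apply: pospartB.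
  rewrite e scalerBr !scalerBl -!scaler_nat !natz; lattice.
rewrite -!big_split; apply: eq_bigr => k _ /=.
have e : (pos (u + w)%R k + neg u k + neg w k =
      neg (u + w)%R k + pos u k + pos w k)%N.
  rewrite /pos /neg !mxE.
  move: ((u : Mlat) k 0) ((w : Mlat) k 0) => a b.
  exact: pospartD.
have collect (a b : P) i1 j1 i2 j2 i3 j3 :
    a ^+ i1 * b ^+ j1 * (a ^+ i2 * b ^+ j2) * (a ^+ i3 * b ^+ j3) =
    a ^+ (i1 + i2 + i3) * b ^+ (j1 + j2 + j3) by rewrite !exprD; ring.
by rewrite !collect e.
Qed.

(** [V p s] compares $p$ with the quotient of [PP s] by [QQ s], after clearing the denominator. The
    quotients are multiplicative in $s$, which makes [V] additive. *)
Lemma lift_potential : exists V : P -> Mlat -> K, additive_on_lifts V /\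
  forall p q s, islift p s -> islift q s -> V p s - V q s = co (s - R) (h (p - q)).
Proof.
have [PP [QQ [dP [dQ [PPP QQP dPQ PQ]]]]] := difference_of_lifts.
pose V p s := co (dP s - R) (h (p * QQ s - PP s)).
have pQ p s : islift p s -> islift (p * QQ s) (dP s).
  by move=> ps; rewrite -dPQ; apply: isliftM.
exists V; split=> [p s q t ps qt|p q s ps qs]; last first.
  rewrite /V -(lift_cocycle (pQ _ _ ps) (pQ _ _ qs) (PPP s)) addrK -dPQ.
  exact: lift_shift (QQP s).
have pq := isliftM ps qt; rewrite /V.
have rPQ := isliftM (QQP s) (QQP t); have rPQ' := isliftM qt (QQP t).
(* The three differences are moved to one degree, where [lift_cocycle] relates them. *)
rewrite -(lift_shift (pQ _ _ pq) (PPP _) rPQ).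
rewrite -(lift_shift (pQ _ _ ps) (PPP _) (isliftM (pQ _ _ qt) (QQP (s + t)))).
rewrite -(lift_shift (pQ _ _ qt) (PPP _) (isliftM (PPP s) (QQP (s + t)))).
have -> : dP (s + t) + (dQ s + dQ t) = dP s + (dP t + dQ (s + t)).
  by rewrite -!dPQ; lattice.
have -> : dP t + (dP s + dQ (s + t)) = dP s + (dP t + dQ (s + t)) by lattice.
have -> : PP (s + t) * (QQ s * QQ t) = PP t * (PP s * QQ (s + t)).
  by rewrite mulrA PQ; ring.
have -> : q * QQ t * (PP s * QQ (s + t)) = PP s * (q * QQ t * QQ (s + t)) by ring.
have -> : p * q * QQ (s + t) * (QQ s * QQ t) = p * QQ s * (q * QQ t * QQ (s + t)) by ring.
apply/esym/lift_cocycle.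
- by apply: isliftM (pQ _ _ ps) _; apply: isliftM (pQ _ _ qt) (QQP _).
- by apply: isliftM (PPP _) _; apply: isliftM (pQ _ _ qt) (QQP _).
rewrite (_ : dP s + (dP t + _) = dP t + (dP s + dQ (s + t))); last by lattice.
by apply: isliftM (PPP _) _; apply: isliftM (PPP _) (QQP _).
Qed.

Lemma represents_decomposition : exists G g, partially_additive G /\
  represents (fun f => h f - der g f) G.
Proof.
have [V [aV VP]] := lift_potential.
pose G s := V (std_lift s) s.
(* The variable ['X_i] need not be proportional to the standard lift of its degree. For a nonzero
   coefficient the correction is the difference of potentials of the two lifts; for a zero one
   ['X_i] lies in the ideal, and the value of [h] on it is prescribed. *)
pose b i := if coef i == 0 then co (gdeg i - R) (h 'X_i)
  else coef i * (V (unitary U_(i)) (gdeg i) - G (gdeg i)).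
pose g i : A := b i *: chi (gdeg i - R).
pose g' i := log_field G i + chi p0 * g i.
have g'E i : g' i = (coef i * G (gdeg i) + b i) *: chi (gdeg i + (p0 - R)).
  rewrite /g' /log_field /g -scalerAr scalerDl; congr (_ + _).
  have [iR|iR] := boolP (gdeg i - R \in S).
    by rewrite chiM //; congr (_ *: chi _); lattice.
  suff -> : b i = 0 by rewrite !scale0r.
  rewrite /b; case: eqP => [_|/eqP ci]; first exact: co_out.
  have iS := coef_deg ci; rewrite VP ?co_out ?mulr0 //; last exact: islift_lift.
  by rewrite -[X in islift _ X]degmU; apply: islift_unitary; rewrite coefmU.
exists G, g; split.
  move=> s t sS tS stR; apply/eqP; rewrite /G -subr_eq0 -aV; try exact: islift_lift.
  rewrite VP ?co_out //; first by apply: islift_lift; apply: (monoidD B).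
  by apply: isliftM; apply: islift_lift.
have hg' f : ev f = 0 -> chi p0 * h f = der g' f.
  apply: (ideal_linear_eq (ideal_linear_mull _ hl) (der_ideal_linear _)) => m.
  have g'h i : is_homog (gdeg i + (p0 - R)) (g' i) by rewrite g'E; apply: is_homog_chi.
  have [cm|cm] := eqVneq (coefm m) 0; last first.
    have mS := coefm_degm cm.
    have hh : is_homog (degm m + (p0 - R)) (chi p0 * h (relator m)).
      rewrite (_ : degm m + (p0 - R) = p0 + (degm m - R)); last by lattice.
      apply: is_homogM; last exact: h_homog (ev_relator m) (@relator_homog m).
      by rewrite -[chi p0]scale1r; apply: is_homog_chi.
    rewrite (homog_chi hh) [RHS](homog_chi (der_homog g'h (@relator_homog m))).
    congr (_ *: _); rewrite co_chiM //.
    rewrite (_ : degm m + (p0 - R) - p0 = degm m - R); last by lattice.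
    rewrite relator_unitary // derZ coZ (ideal_linearZ hl) ?coZ; last first.
      by rewrite evB ev_unitary // ev_lift // subrr.
    congr (_ * _); rewrite -VP; try exact: islift_unitary; try exact: islift_lift.
    rewrite derB coB.
    have [cr dr] := repP mS.
    have VE m' : coefm m' != 0 -> V (unitary m') (degm m') =
        co (degm m' + (p0 - R)) (der g' (unitary m')).
      move=> cm'; rewrite (additive_on_lifts_monomial aV (fun i _ => erefl) cm').
      apply/esym; apply: (additive_on_lifts_monomial (@der_coef_additive _ _)) => // i ci.
      rewrite der_unitaryU g'E coZ co_chi // eqxx mulr1 /b (negbTE ci) addrC.
      by rewrite mulrBr subrK mulrA mulVf // mul1r.
    by rewrite VE // /std_lift -{1 3}dr VE // dr.
  (* A monomial with coefficient zero has a factor ['X_i] in the ideal, on which [h] and [g'] match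
     by the choice of [b]. *)
  rewrite /relator cm scale0r subr0.
  have [i [m' [-> ci]]] : exists i m', m = (U_(i) + m')%MM /\ coef i = 0.
    move: cm; elim/mnm_ind: m => [|i m IH].
      by rewrite coefm0 => /eqP; rewrite oner_eq0.
    rewrite coefmD coefmU => /eqP; rewrite mulf_eq0 => /orP[]/eqP h0.
      by exists i, m.
    have [j [m' [e cj]]] := IH h0; exists j, (U_(i) + m')%MM; split=> //.
    by rewrite e !addmA (addmC U_(i)%MM).
  have ei : ev 'X_i = 0 by rewrite (proj1 (ev_monomial _)) coefmU ci scale0r.
  rewrite mpolyXD ['X_i * 'X_[_]]mulrC (ideal_linearM hl) //.
  rewrite derM ei mul0r addr0 derX mulrCA; congr (_ * _).
  have hi : is_homog (gdeg i - R) (h 'X_i).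
    by apply: h_homog => // m0; rewrite msuppX inE => /eqP ->; apply: degmU.
  by rewrite (homog_chi hi) /g' log_field_coef0 // add0r /g /b ci eqxx.
move=> f f0; rewrite mulrBr hg' // mulr_sumr -sumrB; apply: eq_bigr => i _.
by rewrite /g' mulrDl mulrA addrK.
Qed.
End Decomposition.

Lemma ideal_linear_mod_sq h f g (s : seq (P * P)) : ideal_linear h ->
  ev g = 0 -> (forall q, q \in s -> ev q.1 = 0 /\ ev q.2 = 0) ->
  f - g = \sum_(q <- s) q.1 * q.2 -> h f = h g.
Proof.
move=> hl g0 sI fg.
have [e1 e2] : ev (f - g) = 0 /\ h (f - g) = 0.
  rewrite fg; elim: s sI {fg} => [|q s IH] sI.
    by rewrite big_nil ev0 (ideal_linear0 hl).
  have [q1 q2] := sI q (mem_head _ _).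
  have [e1 e2] := IH (fun r rs => sI r (mem_behead (s := q :: s) rs)).
  by rewrite big_cons evD evM q1 mul0r add0r e1 hl // q1 mul0r add0r e2.
by rewrite -[f](subrK g) (ideal_linearD hl) // e2 add0r.
Qed.

(** [h] and the function [G'] that represents it up to a derivation admit the same coefficients:
    derivations translate into additive functions by [represents_der_additive], and back by
    [represents_additive_der]. *)
Lemma deformation_basis d (G : 'I_d -> Mlat -> K) :
  (forall i, partially_additive (G i)) ->
  (forall G', partially_additive G' -> exists! c : 'rV[K]_d,
    exists l : Mlat -> K, (forall u v, l (u + v) = l u + l v) /\
      forall s, s \in S -> s - R \notin S -> G' s - \sum_i c 0 i * G i s = l s) ->
  exists e : 'I_d -> P -> A,
    (forall i, ideal_linear (e i) /\ forall mu f,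
       ev f = 0 -> poly_homog gdeg mu f -> is_homog (mu - R) (e i f)) /\
    forall h, ideal_linear h ->
      (forall mu f, ev f = 0 -> poly_homog gdeg mu f -> is_homog (mu - R) (h f)) ->
      exists! c : 'rV[K]_d, exists g : 'I_n -> A,
        forall f, ev f = 0 -> h f - \sum_i c 0 i *: e i f = der g f.
Proof.
move=> Gadd Gdec.
have [e eP] := choice (fun i => represents_exists (Gadd i)).
exists e; split=> [i|h hl hh]; first by have [el _ eh] := eP i.
have [G' [g [G'add hG']]] := represents_decomposition hl hh.
suff key (c : 'rV_d) : (exists g : 'I_n -> A,
      forall f, ev f = 0 -> h f - \sum_i c 0 i *: e i f = der g f) <->
    exists l : Mlat -> K, (forall u v, l (u + v) = l u + l v) /\
      forall s, s \in S -> s - R \notin S -> G' s - \sum_i c 0 i * G i s = l s.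
  have [c [hc cu]] := Gdec G' G'add; exists c; split=> [|c' /key]; last exact: cu.
  exact/key.
pose hc f := h f - der g f - \sum_i c 0 i *: e i f.
pose Gc s := G' s - \sum_i c 0 i * G i s.
have hE f : h f - \sum_i c 0 i *: e i f = hc f + der g f.
  by rewrite /hc [in RHS]addrAC subrK.
have hcl : ideal_linear hc.
  apply: ideal_linearB; first by apply: ideal_linearB => //; exact: der_ideal_linear.
  move=> p f k f0 k0; rewrite mulr_sumr -big_split; apply: eq_bigr => i _ /=.
  by have [-> // _ _] := eP i; rewrite scalerDr scalerAr.
have hcG : represents hc Gc.
  move=> f f0; rewrite /hc mulrBr hG' // mulr_sumr.
  have -> : \sum_i chi p0 * (c 0 i *: e i f) =
      \sum_i c 0 i *: der (log_field (G i)) f.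
    by apply: eq_bigr => i _; have [_ er _] := eP i; rewrite -scalerAr er.
  rewrite /der; under [X in _ - X]eq_bigr do rewrite scaler_sumr.
  rewrite exchange_big -sumrB; apply: eq_bigr => j _ /=.
  under eq_bigr do rewrite scalerAl.
  rewrite -mulr_suml -mulrBl; congr (_ * _).
  rewrite /log_field /Gc mulrBr scalerBl; congr (_ - _).
  rewrite mulr_sumr scaler_suml; apply: eq_bigr => i _.
  by rewrite scalerA mulrCA.
have Gca : partially_additive Gc.
  move=> s t sS tS stR; rewrite /Gc G'add //.
  have -> : \sum_i c 0 i * G i (s + t) = \sum_i c 0 i * G i s + \sum_i c 0 i * G i t.
    by rewrite -big_split; apply: eq_bigr => i _; rewrite Gadd // mulrDr.
  by rewrite opprD addrACA.
split=> [[g1 hg1]|[l [lD lG]]].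
  apply: (represents_der_additive (g := fun i => g1 i - g i) hcG Gca) => f fI.
  have := hg1 f fI; rewrite hE => /eqP; rewrite eq_sym -subr_eq => /eqP <- /=.
  by rewrite /der -sumrB; apply: eq_bigr => i _; rewrite mulrBl.
have [g1 hg1] := represents_additive_der hcl hcG lD lG.
exists (fun i => g1 i + g i) => f fI; rewrite hE hg1 //.
by rewrite /der -big_split; apply: eq_bigr => i _; rewrite mulrDl.
Qed.
End Presentation.

(** * From partially additive functions to the dimension of $T^1$ *)

Section DimT1.
Variables (K : fieldType) (tau : polycone) (X : presentation K tau).
Notation S := (dual_lattice tau).
Notation B := (coord_monoid_alg K tau).
Notation A := (carrier B).
Notation n := (nvars X).
Notation P := {mpoly K[n]}.
Notation x := (@gen K tau X : 'I_n -> A).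
Notation gdeg := (@gdeg K tau X).
Notation ev := (eval_alg x).
Notation inI := (@in_ideal K tau X).

Lemma ring_homogP mu (f : coord_ring K tau) :
  ring_homog mu f <-> is_homog (B := B) mu f.
Proof.
split=> [hf u ne|hf s].
  rewrite /= /coef_at; case e : (toS tau u) => [s|//].
  have su : val s = u by move: e; rewrite /toS; case: insubP => // t _ <- [->].
  have nf : s \notin monalg.msupp f.
    by apply/negP => /hf; rewrite su => /eqP; rewrite (negbTE ne).
  exact: monalg.mcoeff_outdom nf.
rewrite -monalg.mcoeff_neq0; apply: contraNeq => ne.
by have := hf (val s) ne; rewrite /= /coef_at toS_val => ->.
Qed.

Lemma gen_is_homog i : is_homog (B := B) (gdeg i) (x i).
Proof. exact/ring_homogP/gen_homog. Qed.

Lemma gen_surjA (f : A) : exists p, ev p = f.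
Proof. exact: gen_surj. Qed.

Definition to_ideal (f : P) (fI : inI f) : ideal X := exist _ f fI.

Definition extend0 (h : ideal X -> A) (f : P) : A :=
  if pselect (inI f) is left fI then h (to_ideal fI) else 0.

Lemma in_idealP (f : P) : reflect (ev f = 0) (inI f).
Proof. exact: eqP. Qed.

Lemma extend0E h (f : ideal X) : extend0 h (val f) = h f.
Proof.
rewrite /extend0; case: pselect => [fI|]; last by case: f.
by congr h; apply: val_inj.
Qed.

Lemma extend0_linear h : normal_hom X h -> ideal_linear x (extend0 h).
Proof.
move=> [_ hl] p f g /in_idealP f0 /in_idealP g0.
have k0 : inI (p * f + g).
  move/in_idealP: f0 => f0; move/in_idealP: g0 => g0.
  by apply/in_idealP; rewrite evD evM f0 g0 mulr0 addr0.
have := hl p (to_ideal f0) (to_ideal g0) (to_ideal k0) erefl.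
rewrite -!extend0E; exact.
Qed.

Lemma ideal_linear_normal_hom (h : P -> A) : ideal_linear x h ->
  normal_hom X (fun f => h (val f)).
Proof.
move=> hl.
have vI (f : ideal X) : ev (val f) = 0 by apply/in_idealP; case: f.
split=> [f g [s e]|p f g k ->]; last by apply: hl.
have e' : val f - val g = \sum_(q <- [seq (val q.1, val q.2) | q <- s]) q.1 * q.2.
  by rewrite e big_map.
apply: (ideal_linear_mod_sq hl (vI g) _ e') => q /mapP[r _ ->].
by split; apply: vI.
Qed.

Lemma derivation_homP (h : ideal X -> A) :
  derivation_hom X h <-> exists g : 'I_n -> A,
    forall f : ideal X, h f = der x g (val f).
Proof.
split=> [[g hg]|[g hg]].
  by exists (fun i => ev (g i)) => f; rewrite hg; apply: ev_derivation.
have [g' hg'] := der_lift gen_surjA g.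
by exists g' => f; rewrite hg; apply/esym/hg'.
Qed.

Variable (R : Mlat).
Hypothesis deep : exists p0, [/\ p0 \in S, p0 - R \in S &
  forall i, gdeg i + (p0 - R) \in S].
Hypothesis S_generates : forall u, exists s t, [/\ s \in S, t \in S & u = s - t].

Lemma dim_T1_partially_additive d (G : 'I_d -> Mlat -> K) :
  (forall i, partially_additive S R (G i)) ->
  (forall G', partially_additive S R G' -> exists! c : 'rV[K]_d,
    exists l : Mlat -> K, (forall u v, l (u + v) = l u + l v) /\
      forall s, s \in S -> s - R \notin S -> G' s - \sum_i c 0 i * G i s = l s) ->
  dim_T1 X (- R) d.
Proof.
move=> Gadd Gdec; have [p0 [p0S p0R p0d]] := deep.
have [e [eP hP]] := deformation_basis gen_is_homog gen_surjA p0S p0R p0d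
  S_generates Gadd Gdec.
exists (fun i f => e i (val f)); split=> [i|h [hn hd]].
  have [el eh] := eP i; split; first exact: ideal_linear_normal_hom.
  by move=> mu f fh; apply/ring_homogP/eh => //; apply/in_idealP; case: f {fh}.
have hh mu f : ev f = 0 -> poly_homog gdeg mu f ->
    is_homog (B := B) (mu - R) (extend0 h f).
  move=> /in_idealP f0 fh; apply/ring_homogP.
  by have := hd mu (to_ideal f0) fh; rewrite -extend0E.
have hE (c : 'rV_d) (f : ideal X) : (h - \sum_i c 0 i *: (fun f => e i (val f))) f =
    extend0 h (val f) - \sum_i c 0 i *: e i (val f).
  by rewrite extend0E; congr (_ - _); rewrite fct_sumE; apply: eq_bigr.
have [c [[g hc] cu]] := hP _ (extend0_linear hn) hh.
exists c; split=> [|c' /derivation_homP[g' hg']].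
  apply/derivation_homP; exists g => f; rewrite hE hc //.
  by apply/in_idealP; case: f.
apply: cu; exists g' => f /in_idealP fI.
by have := hg' (to_ideal fI); rewrite hE.
Qed.
End DimT1.

(** * Partially additive functions along a chain of facets *)

Definition ip (v : 'rV[int]_3) (u : Mlat) : int := (v *m u) 0 0.

Lemma ipD v u u' : ip v (u + u') = ip v u + ip v u'.
Proof. by rewrite /ip mulmxDr mxE. Qed.
Lemma ipB v u u' : ip v (u - u') = ip v u - ip v u'.
Proof. by rewrite /ip mulmxBr !mxE. Qed.
Lemma ipZ v c u : ip v (c *: u) = c * ip v u.
Proof. by rewrite /ip -scalemxAr mxE. Qed.
Lemma ip0 v : ip v 0 = 0.
Proof. by rewrite /ip mulmx0 mxE. Qed.
Lemma ipMn v u n : ip v (u *+ n) = ip v u *+ n.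
Proof. by rewrite -scaler_nat ipZ mulr_natl. Qed.
Lemma ipBl v v' u : ip (v - v') u = ip v u - ip v' u.
Proof. by rewrite /ip mulmxBl !mxE. Qed.
Lemma ipMnl v u n : ip (v *+ n) u = ip v u *+ n.
Proof. by rewrite /ip -scaler_nat -scalemxAl mxE mulr_natl. Qed.

Section Chain.
Variables (K : fieldType) (S : pred Mlat) (chi0 : Mlat) (k a : nat).
Variables (A dir : nat -> 'rV[int]_3) (len : nat -> nat).
Hypothesis S_0 : 0 \in S.
Hypothesis S_D : forall s t, s \in S -> t \in S -> s + t \in S.
Hypothesis A_chi0 : forall i, (i <= k)%N -> ip (A i) chi0 = 1.
Hypothesis A_ge0 : forall i s, (i <= k)%N -> s \in S -> 0 <= ip (A i) s.
Hypothesis a_ge2 : (2 <= a)%N.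
Notation R := (chi0 *+ a).
Hypothesis S_outP : forall s, s \in S ->
  (s - R \notin S) <-> exists2 i, (i <= k)%N & ip (A i) s < a%:Z.
Hypothesis facet : forall i, (i <= k)%N -> exists f, [/\ f \in S, ip (A i) f = 0 &
  forall u, 0 <= ip (A i) u -> exists N, u + f *+ N \in S].
Hypothesis ridge : forall i, (i < k)%N ->
  exists f, [/\ f \in S, ip (A i) f = 0, ip (A i.+1) f = 0 &
    forall u, 0 <= ip (A i) u -> 0 <= ip (A i.+1) u -> exists N, u + f *+ N \in S].
Hypothesis between : forall i m j s, (i <= m <= j)%N -> (j <= k)%N -> s \in S ->
  ip (A i) s < a%:Z -> ip (A j) s < a%:Z -> ip (A m) s < a%:Z.
Hypothesis dirP : forall i, (i < k)%N -> A i.+1 - A i = dir i *+ len i.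
Hypothesis dir_prim : forall i, (i < k)%N -> exists w, ip (dir i) w = 1.
Hypothesis len_gt0 : forall i, (i < k)%N -> (0 < len i)%N.

Notation additive l := (forall u v, l (u + v) = l u + l v :> K).

Lemma additiveB (l : Mlat -> K) u v : additive l -> l (u - v) = l u - l v.
Proof. by move=> lD; apply/eqP; rewrite eq_sym subr_eq -lD subrK. Qed.

Lemma additive0 (l : Mlat -> K) : additive l -> l 0 = 0.
Proof. by move=> lD; rewrite -(subrr 0) additiveB // subrr. Qed.

Lemma additiveMn (l : Mlat -> K) u n : additive l -> l (u *+ n) = l u *+ n.
Proof.
by move=> lD; elim: n => [|n IH]; rewrite ?mulr0n ?additive0 // !mulrS lD IH.
Qed.

Lemma additiveZ (l : Mlat -> K) z u : additive l -> l (z *: u) = z%:~R * l u.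
Proof.
move=> lD; have lZn n : l (n%:Z *: u) = n%:R * l u.
  by rewrite -natz scaler_nat additiveMn // mulr_natl.
case: z => n; first exact: lZn.
rewrite NegzE scaleNr -[- (_ *: u)]add0r additiveB // additive0 // lZn sub0r.
by rewrite rmorphN mulNr.
Qed.

Lemma S_Mn u n : u \in S -> u *+ n \in S.
Proof. by move=> uS; elim: n => [|n IH]; rewrite ?mulr0n // mulrS S_D. Qed.

Lemma dir_chi0 i : (i < k)%N -> ip (dir i) chi0 = 0.
Proof.
move=> ik; have := congr1 (ip^~ chi0) (dirP ik).
rewrite ipBl ipMnl !A_chi0 // ?(ltnW ik) // subrr => /esym/eqP; rewrite mulrn_eq0.
by rewrite eqn0Ngt len_gt0 // => /eqP.
Qed.

Lemma ip_step i u : (i < k)%N -> ip (A i.+1) u = ip (A i) u + ip (dir i) u *+ len i.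
Proof. by move=> ik; rewrite -ipMnl -dirP // ipBl addrC subrK. Qed.

Lemma ip_proj i u : (i <= k)%N -> ip (A i) (u - ip (A i) u *: chi0) = 0.
Proof. by move=> ik; rewrite ipB ipZ A_chi0 // mulr1 subrr. Qed.

(** Adding multiples of [f], an element of the facet on which [l] vanishes, brings every $u$ with $0
    \le \langle A_i, u\rangle < a$ into [S]. Such $u$ generate the lattice, since [chi0] has height
    $1 < a$. *)
Lemma facet_span (l : Mlat -> K) i : (i <= k)%N -> additive l ->
  (forall s, s \in S -> ip (A i) s < a%:Z -> l s = 0) -> forall u, l u = 0.
Proof.
move=> ik lD l0; have [f [fS fi fdeep]] := facet ik.
have lf : l f = 0 by apply: l0; rewrite // fi; lia.
have lsmall u : 0 <= ip (A i) u < a%:Z -> l u = 0.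
  move=> /andP[u0 ua]; have [N uS] := fdeep _ u0.
  have := l0 _ uS; rewrite lD additiveMn // lf mul0rn addr0; apply.
  by rewrite ipD ipMn fi mul0rn addr0.
have lchi : l chi0 = 0 by apply: lsmall; rewrite A_chi0 //; lia.
move=> u; rewrite -[u](subrK (ip (A i) u *: chi0)) lD additiveZ // lchi mulr0 addr0.
by apply: lsmall; rewrite ip_proj //; lia.
Qed.

(** As for one facet, [l] vanishes on all $u$ whose values at [A i] and [A i.+1] lie in $[0, a)$.
    Subtracting a multiple of [chi0] makes these values $0$ and [len i] times $\langle dir_i,
    u\rangle$, so [l] kills the kernel of [dir i]; if the edge is short, it also kills [w]. *)
Lemma ridge_span (l : Mlat -> K) i : (i < k)%N -> additive l ->
  (forall s, s \in S -> ip (A i) s < a%:Z -> ip (A i.+1) s < a%:Z -> l s = 0) ->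
  exists c : K, ((len i < a)%N -> c = 0) /\ forall u, l u = c * (ip (dir i) u)%:~R.
Proof.
move=> ik lD l0; have [f [fS fi fi1 fdeep]] := ridge ik.
have lf : l f = 0 by apply: l0; rewrite // ?fi ?fi1; lia.
have lsmall u : 0 <= ip (A i) u < a%:Z -> 0 <= ip (A i.+1) u < a%:Z -> l u = 0.
  move=> /andP[u0 ua] /andP[u0' ua']; have [N uS] := fdeep _ u0 u0'.
  have := l0 _ uS; rewrite lD additiveMn // lf mul0rn addr0; apply.
    by rewrite ipD ipMn fi mul0rn addr0.
  by rewrite ipD ipMn fi1 mul0rn addr0.
have lchi : l chi0 = 0.
  by apply: lsmall; rewrite A_chi0 ?(ltnW ik) //; lia.
have lproj u : (0 <= ip (dir i) u *+ len i < a%:Z) -> l u = 0.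
  move=> h; rewrite -[u](subrK (ip (A i) u *: chi0)) lD additiveZ // lchi mulr0 addr0.
  have ik' := ltnW ik; apply: lsmall; first by rewrite ip_proj //; lia.
  by rewrite ip_step // ip_proj // add0r ipB ipZ dir_chi0 // mulr0 subr0.
have [w wP] := dir_prim ik; exists (l w); split=> [short|u].
  by apply: lproj; rewrite wP natz; lia.
rewrite mulrC -additiveZ //; apply/eqP; rewrite -subr_eq0 -additiveB //; apply/eqP/lproj.
by rewrite ipB ipZ wP mulr1 subrr mul0rn; lia.
Qed.

(** The function is assembled from its restriction [l0] to the hyperplane orthogonal to [A i], whose
    elements are differences of elements of [S], and a slope [g1] along [chi0]. *)
Lemma additive_on_facet G i : (i <= k)%N -> partially_additive S R G ->
  exists l : Mlat -> K, additive l /\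
    forall s, s \in S -> ip (A i) s < a%:Z -> G s = l s.
Proof.
move=> ik Gadd; have [f [fS fi fdeep]] := facet ik.
have GD s t : s \in S -> t \in S -> ip (A i) (s + t) < a%:Z -> G (s + t) = G s + G t.
  by move=> sS tS st; apply: Gadd => //; apply/S_outP; [apply: S_D|exists i].
have G0 : G 0 = 0.
  have /eqP := GD 0 0 S_0 S_0 ltac:(rewrite addr0 ip0; lia).
  by rewrite addr0 -subr_eq0 opprD addNKr oppr_eq0 => /eqP.
pose T : pred Mlat := [pred s | (s \in S) && (ip (A i) s == 0)].
have TP s : s \in T = (s \in S) && (ip (A i) s == 0) by [].
have [s t|l0 [l0T l0D]] := @additive_extension _ K T G.
  rewrite !TP => /andP[sS /eqP s0] /andP[tS /eqP t0].
  by rewrite S_D // ipD s0 t0 addr0 eqxx GD // ipD s0 t0; lia.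
have fT N : f *+ N \in T by rewrite TP S_Mn // ipMn fi mul0rn eqxx.
have l0D' u v : ip (A i) u = 0 -> ip (A i) v = 0 -> l0 (u + v) = l0 u + l0 v.
  have perp w : ip (A i) w = 0 -> exists s t, [/\ s \in T, t \in T & w = s - t].
    move=> w0; have [|N wN] := fdeep w; first by rewrite w0.
    exists (w + f *+ N), (f *+ N); rewrite fT addrK; split=> //.
    by rewrite TP wN ipD w0 ipMn fi mul0rn.
  by move=> /perp hu /perp hv; apply: l0D.
have l00 : l0 0 = 0 by rewrite l0T ?G0 // TP S_0 ip0 eqxx.
have fMn N : ip (A i) (f *+ N) = 0 by rewrite ipMn fi mul0rn.
have l0f N : l0 (f *+ N) = l0 f *+ N.
  by elim: N => [|N IH]; rewrite ?mulr0n // !mulrS l0D' ?IH.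
have [|N1 c1S] := fdeep chi0; first by rewrite A_chi0.
(* [chi0] may lie outside [S], so it is translated into [S] along the facet; [g1] is the value at
   [chi0] forced by [G c1]. *)
pose c1 := chi0 + f *+ N1; pose g1 := G c1 - l0 f *+ N1.
have ic1 m : ip (A i) (c1 *+ m) = m%:Z.
  by rewrite ipMn ipD A_chi0 // fMn addr0 natz.
pose proj u := u - ip (A i) u *: chi0.
exists (fun u => l0 (proj u) + g1 * (ip (A i) u)%:~R); split=> [u v|s sS sa].
  have -> : proj (u + v) = proj u + proj v.
    by rewrite /proj ipD scalerDl opprD addrACA.
  by rewrite l0D' ?ip_proj // ipD rmorphD /=; ring.
have [m e] : exists m : nat, ip (A i) s = m%:Z.
  by have := A_ge0 ik sS; case: (ip (A i) s) => // m _; exists m.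
rewrite e in sa.
have Gc1 j : (j <= m)%N -> G (c1 *+ j) = G c1 *+ j.
  elim: j => [_|j IH jm]; first by rewrite !mulr0n G0.
  by rewrite !mulrS GD ?S_Mn ?IH ?(ltnW jm) // -mulrS ic1; lia.
have [|N uN] := fdeep (proj s); first by rewrite ip_proj.
have uT : proj s + f *+ N \in T by rewrite TP uN ipD ip_proj // fMn.
(* After a shift along the facet, $s$ is a sum of copies of [c1] and an element of height zero. All
   partial sums have height below $a$, so [G] can be expanded on both sides. *)
have key : s + f *+ (N + N1 * m) = c1 *+ m + (proj s + f *+ N).
  rewrite /proj e /c1 mulrnDl -mulrnA mulrnDr -[m%:Z]natz scaler_nat.
  by rewrite addrACA [chi0 *+ m + _]addrC subrK [f *+ N + _]addrC addrCA addrA.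
have := congr1 G key; rewrite GD ?S_Mn //; last by rewrite ipD fMn addr0 e.
rewrite GD ?S_Mn //; last by rewrite ipD ic1 ipD ip_proj // fMn !addr0.
rewrite Gc1 // -[G (f *+ _)]l0T // -[G (proj s + _)]l0T // l0D' ?ip_proj // !l0f e.
rewrite mulrnDr mulrnA -(mulr_natr (G c1)) -(mulr_natr (_ *+ _)) -pmulrn /g1.
move: (G s) (l0 (proj s)) (G c1) (l0 f *+ N) (l0 f *+ N1) (m%:R).
move=> x1 x2 x3 x4 x5 x6 eqn; apply: (addIr (x4 + x5 * x6)); rewrite eqn; ring.
Qed.

(** The two values lie in $[0, a)$ and differ by a multiple of [len i], which is at least $a$. *)
Lemma ridge_perp i s : (i < k)%N -> (a <= len i)%N -> s \in S ->
  ip (A i) s < a%:Z -> ip (A i.+1) s < a%:Z -> ip (dir i) s = 0.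
Proof.
move=> ik al sS h h1; have := A_ge0 (ltnW ik) sS; have := A_ge0 ik sS.
move: h1; rewrite ip_step // -mulr_natr natz.
by move: (ip (A i) s) (ip (dir i) s) h => x y h h1 h2 h3; nia.
Qed.

Definition below i s := [exists j : 'I_i.+1, ip (A j) s < a%:Z].
(** A function with a single jump, across edge [i]: the edge direction on $S_0, \dots, S_i$ and zero
    on the remaining $S_j$. *)
Definition basis_fun i (s : Mlat) : K :=
  if below i s then (ip (dir i) s)%:~R else 0.

(** If $s \in S_{j'} \cap S_j$ with $j' \le i < j$, then $s \in S_i \cap S_{i+1}$ by [between], and
    there the direction of a long edge vanishes. *)
Lemma basis_funE i j s : (i < k)%N -> (a <= len i)%N -> (j <= k)%N -> s \in S ->
  ip (A j) s < a%:Z ->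
  basis_fun i s = if (j <= i)%N then (ip (dir i) s)%:~R else 0.
Proof.
move=> ik al jk sS js; rewrite /basis_fun; case: leqP => ji.
  by rewrite ifT //; apply/existsP; exists (Ordinal (ji : (j < i.+1)%N)).
case: ifP => // /existsP[[j' j'i] /= j's].
rewrite (@ridge_perp i s) //; apply: (between _ jk sS j's js); lia.
Qed.

Lemma basis_fun_additive i : (i < k)%N -> (a <= len i)%N ->
  partially_additive S R (basis_fun i).
Proof.
move=> ik al s t sS tS /(S_outP (S_D sS tS))[j jk]; rewrite ipD => h.
have s0 := A_ge0 jk sS; have t0 := A_ge0 jk tS.
rewrite !(@basis_funE i j) ?S_D ?ipD //; try lia.
by case: leqP => _; rewrite ?rmorphD ?addr0.
Qed.

Definition long_edges := [seq i <- iota 0 k | (a <= len i)%N].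

Lemma long_edgesP (q : 'I_(size long_edges)) :
  (nth 0%N long_edges q < k)%N /\ (a <= len (nth 0%N long_edges q))%N.
Proof.
have := mem_nth 0%N (ltn_ord q); rewrite mem_filter mem_iota add0n leq0n.
by move=> /andP[-> /= ->].
Qed.

Lemma sum_long_edges (F : nat -> K) : \sum_(q < size long_edges) F (nth 0%N long_edges q) =
  \sum_(0 <= i < k | (a <= len i)%N) F i.
Proof.
by rewrite -(big_mkord xpredT (fun q => F (nth 0%N long_edges q)))
  -(@big_nth _ _ _ _ 0%N long_edges xpredT F) big_filter /index_iota subn0.
Qed.

(** [H j] is the additive function that the combination induces on $S_j$. All basis functions vanish
    on the last set $S_k$, which spans, so [L] is zero and hence every [H j]; the change of [H]
    across a long edge isolates its coefficient. *)
Lemma basis_fun_free (e : 'rV[K]_(size long_edges)) (L : Mlat -> K) : additive L ->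
  (forall s, s \in S -> s - R \notin S ->
     \sum_q e 0 q * basis_fun (nth 0%N long_edges q) s = L s) -> e = 0.
Proof.
move=> LD eL; pose J (q : 'I_(size long_edges)) := nth 0%N long_edges q.
pose H j u : K := \sum_(q < size long_edges)
  (if (j <= J q)%N then e 0 q * (ip (dir (J q)) u)%:~R else 0).
have HS j s : (j <= k)%N -> s \in S -> ip (A j) s < a%:Z -> H j s = L s.
  move=> jk sS js; rewrite -eL //; last by apply/S_outP => //; exists j.
  apply: eq_bigr => q _; have [qk qa] := long_edgesP q.
  by rewrite (@basis_funE _ j) //; case: ifP => // _; rewrite mulr0.
have L0 : forall u, L u = 0.
  apply: (@facet_span L k (leqnn k) LD) => s sS ks; rewrite -(HS k) // /H big1 // => q _.
  by have [qk _] := long_edgesP q; rewrite leqNgt qk.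
have HD j : additive (H j).
  move=> u v; rewrite -big_split; apply: eq_bigr => q _ /=; case: ifP => _.
    by rewrite ipD rmorphD /= mulrDr.
  by rewrite addr0.
have H0 j u : (j <= k)%N -> H j u = 0.
  move=> jk; apply: (@facet_span (H j) j) => // s sS js.
  by rewrite HS // L0.
apply/rowP => q; rewrite mxE; have [qk _] := long_edgesP q.
have [w wP] := dir_prim qk.
have : H (J q) w - H (J q).+1 w = 0 by rewrite !H0 ?subrr // ltnW.
rewrite -sumrB (bigD1 q) //= leqnn ltnn subr0 wP mulr1 big1 ?addr0 // => r rq.
have : J r != J q by rewrite /J nth_uniq // filter_uniq // iota_uniq.
by rewrite [(J q <= J r)%N]leq_eqVlt eq_sym => /negbTE -> /=; rewrite subrr.
Qed.

(** The coefficients are the factors $c_i$ in $l_i - l_{i+1} = c_i \, dir_i$. On $S_j$ the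
    combination telescopes to $l_j - l_k$, and its subtraction leaves the one additive function
    $l_k$. *)
Lemma partially_additive_decomposition G : partially_additive S R G ->
  exists! c : 'rV[K]_(size long_edges),
    exists l : Mlat -> K, additive l /\ forall s, s \in S -> s - R \notin S ->
      G s - \sum_q c 0 q * basis_fun (nth 0%N long_edges q) s = l s.
Proof.
move=> Gadd.
have lex j : exists l : Mlat -> K, additive l /\ ((j <= k)%N ->
    forall s, s \in S -> ip (A j) s < a%:Z -> G s = l s).
  have [jk|jk] := leqP j k; last by exists (fun=> 0); split=> // *; rewrite addr0.
  by have [l [lD lG]] := additive_on_facet jk Gadd; exists l.
have [l lP] := choice lex; have lD j := (lP j).1.
have cex i : exists c : K, (i < k)%N -> ((len i < a)%N -> c = 0) /\
    forall u, l i u - l i.+1 u = c * (ip (dir i) u)%:~R.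
  have [ik|_] := ltnP i k; last by exists 0.
  have [||c cP] := @ridge_span (fun u => l i u - l i.+1 u) i ik; last by exists c.
    by move=> u v; rewrite !lD; ring.
  move=> s sS si si1; have [[_ hi] [_ hi1]] := (lP i, lP i.+1).
  by rewrite -hi ?(ltnW ik) // -hi1 // subrr.
have [c cP] := choice cex.
have hk s : s \in S -> s - R \notin S ->
    G s - \sum_q (\row_(q < size long_edges) c (nth 0%N long_edges q)) 0 q *
      basis_fun (nth 0%N long_edges q) s = l k s.
  move=> sS /(S_outP sS)[j jk js].
  have [_ /(_ jk s sS js) ->] := lP j.
  have -> : \sum_q (\row_(q < size long_edges) c (nth 0%N long_edges q)) 0 q *
      basis_fun (nth 0%N long_edges q) s = \sum_(j <= i < k) (l i s - l i.+1 s).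
    under [LHS]eq_bigr do rewrite mxE.
    rewrite (sum_long_edges (fun i => c i * basis_fun i s)).
    rewrite (@big_cat_nat _ _ _ j) //= big_nat_cond big1 ?add0r; last first.
      move=> i /andP[/andP[_ ij] al].
      by rewrite (@basis_funE i j) // ?(leq_trans ij) // leqNgt ij mulr0.
    rewrite big_mkcond /=; apply: eq_big_nat => i /andP[ji ik].
    have [c0 cE] := cP i ik; rewrite cE; case: leqP => [al|/c0 ->]; last by rewrite mul0r.
    by rewrite (@basis_funE i j) ?ji.
  rewrite (@telescope_sumr_eq _ j k (fun i => - l i s)) // => [|i _]; ring.
exists (\row_(q < size long_edges) c (nth 0%N long_edges q)); split; first by exists (l k).
move=> c' [l' [l'D hl']]; apply/eqP; rewrite -subr_eq0; apply/eqP.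
apply: (basis_fun_free (L := fun u => l' u - l k u)) => [u v|s sS sR].
  by rewrite l'D lD; ring.
rewrite -hl' // -hk //.
rewrite [RHS](_ : _ = \sum_q (\row_(q < size long_edges) c (nth 0%N long_edges q)) 0 q *
    basis_fun (nth 0%N long_edges q) s - \sum_q c' 0 q * basis_fun (nth 0%N long_edges q) s);
  last by ring.
rewrite -sumrB.
by apply: eq_bigr => q _; rewrite !mxE; ring.
Qed.
End Chain.

(** * Polyhedral cones and their extremal rays *)

Section Perturbation.
Variable R : archiRealFieldType.

Lemma small_perturbation (T : eqType) (s : seq T) (p q : T -> R) :
  (forall x, x \in s -> 0 < p x) ->
  exists e, 0 < e /\ forall d, 0 < d <= e -> forall x, x \in s -> 0 < p x + d * q x.
Proof.
elim: s => [|x s IH] ps; first by exists 1.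
have [|e [e0 he]] := IH; first by move=> y ys; rewrite ps // inE ys orbT.
have px := ps x (mem_head _ _); have q1 : 0 < `|q x| + 1 by rewrite ltr_wpDl.
exists (Num.min e (p x / (`|q x| + 1))); split.
  by rewrite lt_min e0 divr_gt0.
move=> d /andP[d0]; rewrite le_min ler_pdivlMr // => /andP[de dx] y.
rewrite inE => /orP[/eqP ->|ys]; last by rewrite he ?d0.
have : d * - `|q x| <= d * q x
  by rewrite ler_pM2l // lerNl; have := ler_norm (- q x); rewrite normrN.
rewrite mulrN => h; move: dx; rewrite mulrDr mulr1 => dx; lra.
Qed.

Lemma large_multiple (T : eqType) (s : seq T) (p q : T -> R) :
  (forall x, x \in s -> 0 <= p x /\ (p x = 0 -> 0 <= q x)) ->
  exists N : nat, forall M : nat, (N <= M)%N -> forall x, x \in s -> 0 <= q x + p x *+ M.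
Proof.
elim: s => [|x s IH] ps; first by exists 0%N.
have [|N hN] := IH; first by move=> y ys; apply: ps; rewrite inE ys orbT.
have [px qx] := ps x (mem_head _ _).
have [N' hN'] : exists N' : nat, forall M : nat, (N' <= M)%N -> 0 <= q x + p x *+ M.
  have [p0|p0] := eqVneq (p x) 0.
    by exists 0%N => M _; rewrite p0 mul0rn addr0 qx.
  have pp : 0 < p x by rewrite lt_neqAle eq_sym p0.
  exists (Num.bound (`|q x| / p x)) => M hM.
  have := archi_boundP (divr_ge0 (normr_ge0 (q x)) px); rewrite ltr_pdivrMr // => h.
  have : (Num.bound (`|q x| / p x))%:R * p x <= M%:R * p x by rewrite ler_pM2r // ler_nat.
  rewrite -mulr_natl; have := ler_norm (- q x); rewrite normrN; lra.
exists (maxn N N') => M; rewrite geq_max => /andP[h h'] y.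
by rewrite inE => /orP[/eqP ->|ys]; [apply: hN'|apply: hN].
Qed.
End Perturbation.

Lemma pairingDl v w u : pairing (v + w) u = pairing v u + pairing w u.
Proof. by rewrite /pairing mulmxDl mxE. Qed.
Lemma pairingZl t v u : pairing (t *: v) u = t * pairing v u.
Proof. by rewrite /pairing -scalemxAl mxE. Qed.
Lemma pairing0l u : pairing 0 u = 0.
Proof. by rewrite /pairing mul0mx mxE. Qed.
Lemma pairingNl v u : pairing (- v) u = - pairing v u.
Proof. by rewrite -scaleN1r pairingZl mulN1r. Qed.
Lemma pairingBl v w u : pairing (v - w) u = pairing v u - pairing w u.
Proof. by rewrite pairingDl pairingNl. Qed.
Lemma pairingDr v u w : pairing v (u + w) = pairing v u + pairing v w.
Proof. by rewrite /pairing mulmxDr mxE. Qed.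
Lemma pairingZr v t u : pairing v (t *: u) = t * pairing v u.
Proof. by rewrite /pairing -scalemxAr mxE. Qed.
Lemma pairingNr v u : pairing v (- u) = - pairing v u.
Proof. by rewrite -scaleN1r pairingZr mulN1r. Qed.
Lemma pairingBr v u w : pairing v (u - w) = pairing v u - pairing v w.
Proof. by rewrite pairingDr pairingNr. Qed.

Lemma pairing_tr_gt0 (v : NQ) : v != 0 -> 0 < pairing v v^T.
Proof.
move=> v0; rewrite lt_neqAle eq_sym /pairing mxE.
have sq (i : 'I_3) : true -> 0 <= v 0 i * v^T i 0 by rewrite mxE -expr2 sqr_ge0.
rewrite sumr_ge0 ?andbT // psumr_neq0 //.
have [i vi] : exists i, v 0 i != 0 by apply/rV0Pn.
by apply/hasP; exists i; rewrite ?mem_index_enum //= mxE -expr2 exprn_even_gt0.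
Qed.

(** Gordan's alternative, by induction on the number of vectors. If the form [f] found for the tail
    is negative at the head [w], the tail is projected along [w] to the kernel of [f] and treated
    again. *)
Lemma gordan (us : seq NQ) :
  (exists f, forall u, u \in us -> 0 < pairing u f) \/
  exists l : nat -> rat, [/\ forall i, 0 <= l i,
    exists2 i, (i < size us)%N & 0 < l i & \sum_(i < size us) l i *: us`_i = 0].
Proof.
have [m] := ubnP (size us); elim: m us => // m IH [|w us] /= sz.
  by left; exists 0.
have [[f fus]|[l [l0 [i ius li] sl]]] := IH us sz; last first.
  right; exists (fun i => if i is i'.+1 then l i' else 0); split=> [[]//||].
    by exists i.+1.
  by rewrite big_ord_recl scale0r add0r.
have [fw|fw|fw] := ltgtP (pairing w f) 0; last 2 first.
- by left; exists f => u; rewrite inE => /orP[/eqP ->|/fus].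
- have [w0|w0] := eqVneq w 0.
    right; exists (fun i => (i == 0%N)%:R); split=> [i||]; first by rewrite ler0n.
      by exists 0%N.
    by rewrite w0 big_ord_recl scaler0 add0r big1 // => i _; rewrite scale0r.
  have [e [e0 he]] := small_perturbation (fun u => pairing u w^T) fus.
  left; exists (f + e *: w^T) => u; rewrite pairingDr pairingZr inE => /orP[/eqP ->|].
    by rewrite fw add0r mulr_gt0 // pairing_tr_gt0.
  by apply: he; rewrite e0 /=.
pose t u := pairing u f / pairing w f.
have szm : (size [seq (u - t u *: w)%R | u <- us] < m)%N by rewrite size_map.
have [[f' f'us]|[l [l0 [i ius li] sl]]] := IH _ szm; last first.
  (* A relation among the projections lifts; the new coefficient of [w] is nonnegative because [t]
     is negative on the tail. *)
  right; exists (fun i => if i is i'.+1 then l i' else - \sum_(j < size us) l j * t us`_j).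
  rewrite size_map in ius sl; split=> [[|j] //||].
  - rewrite -sumrN sumr_ge0 // => j _; rewrite -mulrN mulr_ge0 //.
    by rewrite /t -mulrN -invrN ltW // divr_gt0 ?oppr_gt0 // fus // mem_nth.
  - by exists i.+1.
  apply: etrans sl; rewrite big_ord_recl /= scaleNr scaler_suml -sumrN -big_split.
  apply: eq_bigr => j _ /=.
  by rewrite (nth_map 0) // scalerBr scalerA addrC.
have pos u : u \in us -> 0 < pairing (u - t u *: w) f'
  by move=> uu; apply: f'us; apply: (map_f (fun u : NQ => u - t u *: w)).
have [e [e0 he]] := small_perturbation t pos.
(* The multiple of [f] gives [w] the value [e], which is small enough for the values on the tail,
   changed by [e * t u], to stay positive. *)
left; exists (f' + ((e - pairing w f') / pairing w f) *: f) => u.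
have fw0 : pairing w f != 0 by rewrite lt_eqF.
rewrite pairingDr pairingZr inE => /orP[/eqP ->|uu]; first by rewrite divfK // addrC subrK.
have := he e _ u uu; rewrite e0 lexx pairingBl pairingZl => /(_ isT) h.
apply: lt_le_trans h _; rewrite /t le_eqVlt; apply/orP; left; apply/eqP.
by field.
Qed.

Section ConeOf.
Variable l : seq NQ.

Lemma cone_of0 : cone_of l 0.
Proof. by exists (fun=> 0); split=> //; rewrite big1 // => i _; rewrite scale0r. Qed.

Lemma cone_ofD v w : cone_of l v -> cone_of l w -> cone_of l (v + w).
Proof.
move=> [c [c0 ->]] [d [d0 ->]]; exists (fun i => c i + d i); split=> [i|].
  by rewrite addr_ge0.
by rewrite -big_split; apply: eq_bigr => i _; rewrite scalerDl.
Qed.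

Lemma cone_ofZ t v : 0 <= t -> cone_of l v -> cone_of l (t *: v).
Proof.
move=> t0 [c [c0 ->]]; exists (fun i => t * c i); split=> [i|].
  by rewrite mulr_ge0.
by rewrite scaler_sumr; apply: eq_bigr => i _; rewrite scalerA.
Qed.

Lemma cone_of_gen v : v \in l -> cone_of l v.
Proof.
move=> vl; have lt : (index v l < size l)%N by rewrite index_mem.
exists (fun i => (i == Ordinal lt)%:R); split=> [i|]; first by rewrite ler0n.
rewrite (bigD1 (Ordinal lt)) //= eqxx scale1r big1 ?addr0 ?nth_index // => i /negbTE ->.
by rewrite scale0r.
Qed.

Lemma cone_of_min (Q : NQ -> Prop) : Q 0 -> (forall v w, Q v -> Q w -> Q (v + w)) ->
  (forall t v, 0 <= t -> v \in l -> Q (t *: v)) -> forall v, cone_of l v -> Q v.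
Proof.
move=> Q0 QD QZ v [c [c0 ->]]; elim/big_ind: _ => // i _.
by apply: QZ => //; apply: mem_nth.
Qed.
End ConeOf.

Lemma cone_of_sub l l' : (forall v, v \in l -> cone_of l' v) ->
  forall v, cone_of l v -> cone_of l' v.
Proof.
move=> sub; apply: cone_of_min; [exact: cone_of0|exact: cone_ofD|].
by move=> t v t0 /sub; apply: cone_ofZ.
Qed.

Lemma cone_of_cons g l v : cone_of (g :: l) v ->
  exists a w, [/\ 0 <= a, cone_of l w & v = a *: g + w].
Proof.
move: v; apply: cone_of_min => [|v w [a [x [a0 xl ->]]] [b [y [b0 yl ->]]]|t v t0].
- by exists 0, 0; rewrite scale0r addr0; split=> //; apply: cone_of0.
- exists (a + b), (x + y); split; [exact: addr_ge0|exact: cone_ofD|].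
  by rewrite scalerDl addrACA.
rewrite inE => /orP[/eqP ->|vl].
  by exists t, 0; rewrite addr0; split=> //; apply: cone_of0.
exists 0, (t *: v); rewrite scale0r add0r; split=> //.
by apply: cone_ofZ (cone_of_gen vl).
Qed.

Lemma clear_denominators (u : MQ) : exists (N : nat) (m : Mlat),
  (0 < N)%N /\ toMQ m = N%:R *: u.
Proof.
pose D := \prod_(i < 3) denq (u i 0).
have D0 : 0 < D by apply: prodr_gt0 => i _; apply: denq_gt0.
have [N e] : exists N : nat, D = N%:Z by case: D D0 => // N _; exists N.
exists N, (\col_i (numq (u i 0) * \prod_(j < 3 | j != i) denq (u j 0))); split.
  by rewrite e in D0.
apply/matrixP => i j; rewrite ord1 !mxE rmorphM /= -{2}[u i 0]divq_num_den.
have -> : N%:R = (denq (u i 0))%:~R * (\prod_(j < 3 | j != i) denq (u j 0))%:~R :> rat.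
  by rewrite -rmorphM /= -(bigD1 i (P := xpredT)) //= -/D e -pmulrn.
have d0 : (denq (u i 0))%:~R != 0 :> rat by rewrite intr_eq0 denq_neq0.
by field.
Qed.

Section Cone.
Variable tau : polycone.
Notation C := (cone tau).

Lemma cone0 : C 0. Proof. exact: cone_of0. Qed.
Lemma coneD v w : C v -> C w -> C (v + w). Proof. exact: cone_ofD. Qed.
Lemma coneZ t v : 0 <= t -> C v -> C (t *: v). Proof. exact: cone_ofZ. Qed.

Lemma cone_addr0 v w : C v -> C w -> v + w = 0 -> v = 0.
Proof.
move=> hv hw /eqP; rewrite addrC addr_eq0 => /eqP e.
by apply: (polycone_pointed (p := tau)) => //; rewrite -e.
Qed.

(** Extremality is stated by decompositions inside the cone, so that no supporting form is involved;
    [facet_functional] constructs one afterwards. *)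
Definition extremal g := [/\ C g, g != 0 & forall x y, C x -> C y -> x + y = g ->
  exists2 t, 0 <= t & x = t *: g].

(** A generating list of minimal length is irredundant, and irredundant generators of a pointed cone
    are extremal. *)
Lemma extremal_rays : exists l : seq NQ, (forall v, C v <-> cone_of l v) /\
  forall g, g \in l -> extremal g.
Proof.
pose Q n := `[< exists l : seq NQ, size l = n /\ forall v, C v <-> cone_of l v >].
have exQ : exists n, Q n by exists (size (gens tau)); apply/asboolP; exists (gens tau).
case: (ex_minnP exQ) => n /asboolP[l [sl lC]] nmin; exists l; split=> // g gl.
pose l' := rem g l.
have memll' : l =i g :: l' by apply: perm_mem; apply: perm_to_rem.
have irr : ~ cone_of l' g.
  move=> gl'; have : (n <= size l')%N.
    apply: nmin; apply/asboolP; exists l'; split=> // v; split=> [/lC|].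
      apply: cone_of_sub => w; rewrite memll' inE => /orP[/eqP -> //|].
      exact: cone_of_gen.
    move=> h; apply/lC; move: h; apply: cone_of_sub => w wl'.
    by apply: cone_of_gen; rewrite memll' inE wl' orbT.
  have n0 : (0 < n)%N by rewrite -sl; case: (l) gl.
  by rewrite size_rem // sl; lia.
have l'C v : cone_of l' v -> C v.
  move=> h; apply/lC; move: h; apply: cone_of_sub => w wl'.
  by apply: cone_of_gen; rewrite memll' inE wl' orbT.
have decomp v : C v -> exists a w, [/\ 0 <= a, cone_of l' w & v = a *: g + w].
  move=> /lC h; apply: cone_of_cons; move: h; apply: cone_of_sub => w.
  by rewrite memll'; apply: cone_of_gen.
have gC : C g by apply/lC/cone_of_gen.
split=> // [|x y /decomp[a [w [a0 wl ->]]] /decomp[b [w' [b0 wl' ->]]] e].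
  by apply/eqP => g0; apply: irr; rewrite g0; apply: cone_of0.
have e' : w + w' = (1 - a - b) *: g.
  by rewrite !scalerBl scale1r -[X in X - _ - _]e; lattice.
(* If $a + b < 1$, then [g] is redundant; otherwise $w$ and $w' + (a + b - 1) g$ are opposite
   elements of a pointed cone, so $w = 0$. *)
exists a => //; have [ab|ab] := ltP 0 (1 - a - b).
  case: irr; rewrite -[g](scalerK (lt0r_neq0 ab)) -e'.
  by apply: cone_ofZ; [rewrite invr_ge0 ltW|apply: cone_ofD].
suff -> : w = 0 by rewrite addr0.
apply: (@cone_addr0 w (w' + (a + b - 1) *: g)).
- exact: l'C.
- by apply: coneD (l'C _ wl') _; apply: coneZ gC; lra.
by rewrite addrA e' -scalerDl (_ : 1 - a - b + (a + b - 1) = 0) ?scale0r //; ring.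
Qed.

Lemma extremalZ t g : 0 < t -> extremal g -> extremal (t *: g).
Proof.
move=> t0 [gC g0 ge]; split=> [||x y xC yC e]; first exact: coneZ (ltW t0) gC.
  by rewrite scaler_eq0 negb_or g0 lt0r_neq0.
have tn := lt0r_neq0 t0.
have [|||s s0 xs] := ge (t^-1 *: x) (t^-1 *: y).
- by apply: coneZ; rewrite // invr_ge0 ltW.
- by apply: coneZ; rewrite // invr_ge0 ltW.
- by rewrite -scalerDr e scalerK.
by exists s => //; rewrite scalerA mulrC -scalerA -xs scalerA mulfV // scale1r.
Qed.

Variable l : seq NQ.
Hypothesis lC : forall v, C v <-> cone_of l v.
Hypothesis l_extremal : forall g, g \in l -> extremal g.

Lemma pairing_ge0 u : (forall g, g \in l -> 0 <= pairing g u) ->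
  forall v, C v -> 0 <= pairing v u.
Proof.
move=> h v /lC; move: v; apply: cone_of_min => [|v w|t v t0 /h].
- by rewrite pairing0l.
- by rewrite pairingDl; apply: addr_ge0.
by rewrite pairingZl; apply: mulr_ge0.
Qed.

Lemma positive_combination_neq0 (us : seq NQ) (c : nat -> rat) :
  (forall u, u \in us -> C u /\ u != 0) -> (forall i, 0 <= c i) ->
  (exists2 i, (i < size us)%N & 0 < c i) ->
  \sum_(i < size us) c i *: us`_i != 0.
Proof.
move=> usC c0 [i ius ci]; apply/eqP; rewrite (bigD1 (Ordinal ius)) //= => /cone_addr0 h.
have [uC u0] := usC _ (mem_nth 0 ius).
have /eqP : c i *: us`_i = 0.
  apply: h; first exact: coneZ.
  elim/big_ind: _ => [|v w|j _]; [exact: cone0|exact: coneD|].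
  by apply: coneZ => //; have [] := usC _ (mem_nth 0 (ltn_ord j)).
by rewrite scaler_eq0 (negbTE u0) orbF gt_eqF.
Qed.

Lemma interior_functional : exists f, forall g, g \in l -> 0 < pairing g f.
Proof.
have [//|[c [c0 ci /eqP]]] := gordan l.
by rewrite (negbTE (positive_combination_neq0 _ c0 ci)) // => u /l_extremal[].
Qed.

(** Gordan's alternative for the rays other than that of [w], projected along [w] by means of [u]. A
    relation would write some $s w$ as a nontrivial combination of the other rays, against
    pointedness if $s \le 0$ and against extremality of [w] if $s > 0$. *)
Lemma facet_functional (u : MQ) w : extremal w -> pairing w u = 1 ->
  exists f, pairing w f = 0 /\ forall g, g \in l ->
    0 < pairing g f \/ exists2 t, 0 < t & g = t *: w.
Proof.
move=> [wC w0 we] wu.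
pose far := [seq g <- l | ~~ `[< exists t, g = t *: w >]].
have farP g : g \in far -> [/\ C g, g != 0 & forall t, g != t *: w].
  rewrite mem_filter => /andP[/asboolP h /l_extremal[gC g0 _]]; split=> // t.
  by apply/eqP => e; apply: h; exists t.
have [[f' hf']|[c [c0 ci sc]]] := gordan [seq g - pairing g u *: w | g <- far]; last first.
  rewrite size_map in ci sc.
  have sE : \sum_(i < size far) c i *: far`_i =
      (\sum_(i < size far) c i * pairing far`_i u) *: w.
    apply/eqP; rewrite -subr_eq0 scaler_suml -sumrB; apply/eqP/(etrans _ sc).
    apply: eq_bigr => i _; rewrite (nth_map 0) // scalerBr scalerA //.
  move: sE; set s := (X in X *: w) => sE.
  have farC u' : u' \in far -> C u' /\ u' != 0 by move/farP => [].
  have nz := positive_combination_neq0 farC c0 ci.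
  have [s0|s0] := lerP s 0.
    case/negP: nz; apply/eqP/(@cone_addr0 _ ((- s) *: w)).
    - elim/big_ind: _ => [|v v'|j _]; [exact: cone0|exact: coneD|].
      by apply: coneZ => //; have [] := farC _ (mem_nth 0 (ltn_ord j)).
    - by apply: coneZ wC; rewrite oppr_ge0.
    by rewrite sE scaleNr subrr.
  have [i ifar ci0] := ci.
  have [iC i0 iw] := farP _ (mem_nth 0 ifar).
  have [_ _ swe] := extremalZ s0 (And3 wC w0 we).
  have [|||t t0 e] := swe (c i *: far`_i)
     (\sum_(j < size far | j != Ordinal ifar) c j *: far`_j).
  - exact: coneZ.
  - elim/big_ind: _ => [|v v'|j _]; [exact: cone0|exact: coneD|].
    by apply: coneZ => //; have [] := farC _ (mem_nth 0 (ltn_ord j)).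
  - by rewrite -sE [RHS](bigD1 (Ordinal ifar)).
  case: (elimN eqP (iw ((c i)^-1 * (t * s)))).
  by rewrite -!scalerA -e scalerK // gt_eqF.
exists (f' - pairing w f' *: u); split.
  by rewrite pairingBr pairingZr wu mulr1 subrr.
move=> g gl; have [gfar|] := boolP (g \in far).
  left; have := hf' (g - pairing g u *: w).
  rewrite pairingBl pairingZl pairingBr pairingZr mulrC; apply.
  exact: (map_f (fun g : NQ => g - pairing g u *: w)).
rewrite mem_filter gl andbT negbK => /asboolP[t gt]; right; exists t => //.
have [gC g0 _] := l_extremal gl; rewrite lt_neqAle; apply/andP; split.
  by apply: contraNneq g0 => t0; rewrite gt -t0 scale0r.
rewrite leNgt; apply/negP => t0; case/eqP: g0.
apply: (@cone_addr0 g ((- t) *: w)) => //; last by rewrite gt scaleNr subrr.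
by apply: coneZ wC; rewrite oppr_ge0 ltW.
Qed.
End Cone.

(** * Vertices of the slice *)

Notation i0 := (ord0 : 'I_3).
Notation i1 := (lift ord0 ord0 : 'I_3).
Notation i2 := (lift ord0 (lift ord0 ord0) : 'I_3).

Lemma pairingE v u : pairing v u = v 0 i0 * u i0 0 + v 0 i1 * u i1 0 + v 0 i2 * u i2 0.
Proof. by rewrite /pairing mxE !big_ord_recl big_ord0 addr0 addrA. Qed.

Lemma row3_eq0 (v : NQ) : v 0 i0 = 0 -> v 0 i1 = 0 -> v 0 i2 = 0 -> v = 0.
Proof.
move=> e0 e1 e2; apply/rowP => -[[|[|[|//]]] h]; rewrite mxE.
- by rewrite -e0; congr (v _ _); apply: val_inj.
- by rewrite -e1; congr (v _ _); apply: val_inj.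
- by rewrite -e2; congr (v _ _); apply: val_inj.
Qed.

(** The expansion of $v$ in the orthogonal basis $c$, $p$, $c \times p$, cleared of the denominators
    $|c|^2$ and $|p|^2$; every term has a factor that vanishes by assumption. *)
Lemma orthogonal3 (c1 c2 c3 p1 p2 p3 v1 v2 v3 : rat) :
  c1 * p1 + c2 * p2 + c3 * p3 = 0 -> v1 * p1 + v2 * p2 + v3 * p3 = 0 ->
  v1 * (c2 * p3 - c3 * p2) + v2 * (c3 * p1 - c1 * p3) + v3 * (c1 * p2 - c2 * p1) = 0 ->
  v1 * c1 + v2 * c2 + v3 * c3 = 0 ->
  (p1 * p1 + p2 * p2 + p3 * p3) * (c1 * c1 + c2 * c2 + c3 * c3) != 0 ->
  [/\ v1 = 0, v2 = 0 & v3 = 0].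
Proof.
set cp := c1 * p1 + _ + _; set vp := v1 * p1 + _ + _.
set vq := v1 * (_ - _) + _ + _; set vc := v1 * c1 + _ + _.
set pp := p1 * p1 + _ + _; set cc := c1 * c1 + _ + _ => hcp hvp hvq hvc D0.
have e1 : pp * cc * v1 = cp * cp * v1 + (pp * vc - vp * cp) * c1 +
    (cc * vp - vc * cp) * p1 + vq * (c2 * p3 - c3 * p2).
  by rewrite /cp /vp /vq /vc /pp /cc; ring.
have e2 : pp * cc * v2 = cp * cp * v2 + (pp * vc - vp * cp) * c2 +
    (cc * vp - vc * cp) * p2 + vq * (c3 * p1 - c1 * p3).
  by rewrite /cp /vp /vq /vc /pp /cc; ring.
have e3 : pp * cc * v3 = cp * cp * v3 + (pp * vc - vp * cp) * c3 +
    (cc * vp - vc * cp) * p3 + vq * (c1 * p2 - c2 * p1).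
  by rewrite /cp /vp /vq /vc /pp /cc; ring.
move: e1 e2 e3; rewrite hcp hvp hvq hvc !(mul0r, mulr0, addr0, subr0).
by split; apply: (mulfI D0); rewrite mulr0.
Qed.

(* [q] is the cross product of [c] and [p], so that [c], [p], [q] are orthogonal. *)
Lemma coordinates (c : NQ) (p : MQ) : c != 0 -> p != 0 -> pairing c p = 0 ->
  exists q g : MQ, [/\ pairing c q = 0, pairing c g = 1 &
    forall v, pairing v p = 0 -> pairing v q = 0 -> pairing v g = 0 -> v = 0].
Proof.
move=> c0 p0 cp.
have cc := pairing_tr_gt0 c0.
have pp : 0 < pairing p^T p.
  by rewrite -{2}[p]trmxK pairing_tr_gt0 // trmx_eq0.
pose q : MQ := \col_i [:: c 0 i1 * p i2 0 - c 0 i2 * p i1 0;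
   c 0 i2 * p i0 0 - c 0 i0 * p i2 0; c 0 i0 * p i1 0 - c 0 i1 * p i0 0]`_i.
have q0 : q i0 0 = c 0 i1 * p i2 0 - c 0 i2 * p i1 0 by rewrite mxE.
have q1 : q i1 0 = c 0 i2 * p i0 0 - c 0 i0 * p i2 0 by rewrite mxE.
have q2 : q i2 0 = c 0 i0 * p i1 0 - c 0 i1 * p i0 0 by rewrite mxE.
exists q, ((pairing c c^T)^-1 *: c^T); split=> [||v vp vq].
- by rewrite pairingE q0 q1 q2; ring.
- by rewrite pairingZr mulVf // gt_eqF.
rewrite pairingZr => /eqP; rewrite mulf_eq0 invr_eq0 gt_eqF //= => /eqP vc.
have D0 : pairing p^T p * pairing c c^T != 0 by rewrite mulf_neq0 ?gt_eqF.
move: cp vp vq vc D0; rewrite !pairingE q0 q1 q2 !mxE.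
by move=> cp vp vq vc /(orthogonal3 cp vp vq vc)[*]; apply: row3_eq0.
Qed.

Section Vertices.
Variables (tau : polycone) (l : seq NQ) (c : NQ) (p q g : MQ).
Notation C := (cone tau).
Hypothesis l_extremal : forall v, v \in l -> extremal tau v.
Hypothesis cC : C c.
Hypothesis cp : pairing c p = 0.
Hypothesis cq : pairing c q = 0.
Hypothesis cg : pairing c g = 1.
Hypothesis sep0 : forall v, pairing v p = 0 -> pairing v q = 0 -> pairing v g = 0 -> v = 0.

Definition vertex v := extremal tau v /\ pairing v p = 1.

Lemma separate v w : pairing v p = pairing w p -> pairing v q = pairing w q ->
  pairing v g = pairing w g -> v = w.
Proof.
move=> hp hq hg; apply/eqP; rewrite -subr_eq0; apply/eqP/sep0;
by rewrite pairingBl ?hp ?hq ?hg subrr.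
Qed.

Lemma vertex_cone v : vertex v -> C v. Proof. by case=> -[]. Qed.

Lemma vertex_part v t x y : vertex v -> 0 < t -> C x -> C y -> pairing x p = 1 ->
  t *: x + y = v -> x = v.
Proof.
move=> [[vC v0 ve] vp] t0 xC yC xp e; have [||s s0 es] := ve (t *: x) y _ _ e => //.
  exact: coneZ (ltW t0) xC.
have st : s = t.
  by have := congr1 (pairing^~ p) es; rewrite !pairingZl vp xp !mulr1.
by apply: (scalerI (lt0r_neq0 t0)); rewrite es st.
Qed.

(** Two vertices with equal [q] differ by a multiple of the tail direction [c], so one is the other
    plus a tail element, and extremality makes them equal. *)
Lemma vertex_inj v w : vertex v -> vertex w -> pairing v q = pairing w q -> v = w.
Proof.
wlog h : v w / pairing w g <= pairing v g.
  move=> W vv vw e; have [h|/ltW h] := lerP (pairing w g) (pairing v g); first exact: W.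
  by apply/esym; apply: W.
move=> vv vw e; apply/esym.
apply: (@vertex_part v 1 w ((pairing v g - pairing w g) *: c)) => //.
- exact: vertex_cone.
- by apply: coneZ cC; rewrite subr_ge0.
- by case: vw.
apply: separate; rewrite !(pairingDl, pairingZl) ?cp ?cq ?cg.
- by case: vv vw => _ -> [_ ->]; ring.
- by rewrite e; ring.
by ring.
Qed.

(** At the same [q], the chord and [m] differ by a multiple [t] of [c]. If $t \le 0$, then [m] is a
    sum of nonnegative multiples of [a], [b] and [c], and extremality forces $a = m$. *)
Lemma vertex_between a m b (s : rat) : vertex a -> vertex m -> vertex b -> 0 < s < 1 ->
  a != m -> pairing m q = (1 - s) * pairing a q + s * pairing b q ->
  exists2 t, 0 < t & (1 - s) *: a + s *: b = m + t *: c.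
Proof.
move=> va vm vb /andP[s0 s1] am mq.
pose t := (1 - s) * pairing a g + s * pairing b g - pairing m g.
have e : (1 - s) *: a + s *: b = m + t *: c.
  have [[[_ ap] [_ mp]] [_ bp]] := (va, vm, vb).
  apply: separate; rewrite !(pairingDl, pairingZl) ?cp ?cq ?cg ?ap ?mp ?bp /t ?mq; ring.
exists t => //; rewrite ltNge; apply/negP => t0; case/eqP: am.
apply: (@vertex_part m (1 - s) a (s *: b + (- t) *: c)) => //.
- by rewrite subr_gt0.
- exact: vertex_cone.
- apply: coneD; first exact: coneZ (ltW s0) (vertex_cone vb).
  by apply: coneZ cC; rewrite oppr_ge0.
- by case: va.
by rewrite addrA e scaleNr addrK.
Qed.

(** In the coordinates [q], [g] of the plane [p = 1] this is the equation of the line through [a]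
    and [b], homogenised by [p]; its value at [c] is $\langle b, q\rangle - \langle a, q\rangle$. *)
Definition ridge_functional a b : MQ :=
  (pairing b q - pairing a q) *: (g - pairing a g *: p)
  - (pairing b g - pairing a g) *: (q - pairing a q *: p).

Lemma ridge_functionalE a b v : pairing v (ridge_functional a b) =
  (pairing b q - pairing a q) * (pairing v g - pairing a g * pairing v p)
  - (pairing b g - pairing a g) * (pairing v q - pairing a q * pairing v p).
Proof. by rewrite /ridge_functional !(pairingBr, pairingZr). Qed.

Lemma ridge_functional_ends a b : vertex a -> vertex b ->
  pairing a (ridge_functional a b) = 0 /\ pairing b (ridge_functional a b) = 0.
Proof.
by move=> [_ ap] [_ bp]; rewrite !ridge_functionalE ap bp; split; ring.
Qed.

(* Writing a ray as [alpha a + beta b + gam c], the sign of [gam] is that of the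
   ridge functional; when [gam <= 0], extremality of the ray, of [a] or of [b] is
   contradicted, according to the signs of [alpha] and [beta]. *)
Lemma ridge_functional_gt0 a b : vertex a -> vertex b -> pairing a q < pairing b q ->
  (forall v, vertex v -> pairing a q <= pairing v q <= pairing b q -> v = a \/ v = b) ->
  forall v, v \in l -> 0 < pairing v (ridge_functional a b) \/
    exists2 t, 0 < t & v = t *: a \/ v = t *: b.
Proof.
move=> va vb ab consec v vl; have [ve vC] : extremal tau v /\ C v.
  by have := l_extremal vl; split=> //; case: (l_extremal vl).
have [[_ ap] [_ bp]] := (va, vb); have aC := vertex_cone va; have bC := vertex_cone vb.
have d0 : 0 < pairing b q - pairing a q by rewrite subr_gt0.
have dn := lt0r_neq0 d0.
set f := pairing v _; have [f0|f0] := ltP 0 f; [by left|right].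
pose be := (pairing v q - pairing a q * pairing v p) / (pairing b q - pairing a q).
pose al := pairing v p - be; pose ga := f / (pairing b q - pairing a q).
have ga0 : 0 <= - ga by rewrite /ga -mulNr divr_ge0 ?oppr_ge0 // ltW.
have e : v = al *: a + be *: b + ga *: c.
  apply: separate; rewrite !(pairingDl, pairingZl) ?cp ?cq ?cg ?ap ?bp /al /ga /f
    ?ridge_functionalE /be; by field.
have e' : v + (- ga) *: c = al *: a + be *: b by rewrite {1}e scaleNr addrK.
have gC := coneZ ga0 cC.
have [al0|al0] := lerP 0 al; have [be0|be0] := lerP 0 be.
- have [vp|vp] := ltrP 0 (pairing v p).
    have vv : vertex ((pairing v p)^-1 *: v).
      split; first by apply: extremalZ ve; rewrite invr_gt0.
      by rewrite pairingZl mulVf // gt_eqF.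
    have vqE : pairing v q = al * pairing a q + be * pairing b q.
      by have := congr1 (pairing^~ q) e; rewrite !(pairingDl, pairingZl) cq mulr0 addr0.
    have vpE : pairing v p = al + be by rewrite /al subrK.
    have [|h|h] := consec _ vv.
    + by rewrite pairingZl mulrC ler_pdivlMr // ler_pdivrMr // vqE vpE; nra.
    + by exists (pairing v p) => //; left; rewrite -h scalerA mulfV ?scale1r // gt_eqF.
    by exists (pairing v p) => //; right; rewrite -h scalerA mulfV ?scale1r // gt_eqF.
  have vpE : pairing v p = al + be by rewrite /al subrK.
  have [a0' b0'] : al = 0 /\ be = 0 by rewrite vpE in vp; split; lra.
  case: ve => _ /eqP[]; apply: (cone_addr0 vC gC).
  by rewrite e' a0' b0' !scale0r addr0.
- have bC' : C ((- be) *: b) by apply: coneZ bC; rewrite oppr_ge0 ltW.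
  have := @vertex_part a ((- be) / al) b (al^-1 *: (v + (- ga) *: c)) va _ bC.
  have [al00|al00] := eqVneq al 0.
    move=> _; case: ve => _ /eqP[]; apply: (cone_addr0 vC (coneD gC bC')).
    by rewrite addrA e' al00 scale0r add0r scaleNr subrr.
  have al1 : 0 < al by rewrite lt_neqAle eq_sym al00.
  move=> h; have ba : b = a.
    apply: h => //; first by rewrite divr_gt0 // oppr_gt0.
      by apply: coneZ; [rewrite invr_ge0|apply: coneD].
    rewrite e' scalerDr !scalerA mulVf // scale1r addrCA -scalerDl.
    by rewrite (_ : - be / al + al^-1 * be = 0) ?scale0r ?addr0 //; field.
  by rewrite ba ltxx in ab.
- have aC' : C ((- al) *: a) by apply: coneZ aC; rewrite oppr_ge0 ltW.
  have := @vertex_part b ((- al) / be) a (be^-1 *: (v + (- ga) *: c)) vb _ aC.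
  have [be00|be00] := eqVneq be 0.
    move=> _; case: ve => _ /eqP[]; apply: (cone_addr0 vC (coneD gC aC')).
    by rewrite addrA e' be00 scale0r addr0 scaleNr subrr.
  have be1 : 0 < be by rewrite lt_neqAle eq_sym be00.
  move=> h; have ba : a = b.
    apply: h => //; first by rewrite divr_gt0 // oppr_gt0.
      by apply: coneZ; [rewrite invr_ge0|apply: coneD].
    rewrite e' scalerDr !scalerA mulVf // scale1r addrA -scalerDl.
    by rewrite (_ : - al / be + be^-1 * al = 0) ?scale0r ?add0r //; field.
  by rewrite ba ltxx in ab.
case: ve => _ /eqP[].
apply: (cone_addr0 vC (coneD gC (coneD (coneZ _ aC) (coneZ _ bC)) :
  C (_ + (((- al) *: a) + ((- be) *: b))))).
- by rewrite oppr_ge0 ltW.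
- by rewrite oppr_ge0 ltW.
by rewrite addrA e' addrACA !scaleNr !subrr addr0.
Qed.
End Vertices.

(** * Lattice segments *)

Definition toNQ (v : 'rV[int]_3) : NQ := map_mx intr v.

Lemma pairing_ip v u : pairing (toNQ v) (toMQ u) = (ip v u)%:~R.
Proof. by rewrite /pairing /toNQ /toMQ /ip -map_mxM mxE. Qed.

Lemma lattice_pointP v : lattice_point v <-> exists w, v = toNQ w.
Proof.
split=> [/mxOverP vi|[w ->]]; last by apply/mxOverP => i j; rewrite mxE intr_int.
by exists (map_mx Num.floor v); apply/matrixP => i j; rewrite !mxE floorK.
Qed.

Lemma toNQ_inj : injective toNQ.
Proof.
move=> v w /matrixP e; apply/matrixP => i j.
by have := e i j; rewrite !mxE => /intr_inj.
Qed.

Lemma toNQD v w : toNQ (v + w) = toNQ v + toNQ w.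
Proof. exact: map_mxD. Qed.

Lemma toNQMn v n : toNQ (v *+ n) = toNQ v *+ n.
Proof. exact: raddfMn. Qed.

Lemma ord3_ind (Q : 'I_3 -> Prop) : Q i0 -> Q i1 -> Q i2 -> forall i, Q i.
Proof.
move=> q0 q1 q2 [[|[|[|//]]] h].
- by rewrite (_ : Ordinal h = i0) //; apply: val_inj.
- by rewrite (_ : Ordinal h = i1) //; apply: val_inj.
- by rewrite (_ : Ordinal h = i2) //; apply: val_inj.
Qed.

(** The vector is divided by the gcd of its coordinates; the Bezout coefficients form [w]. *)
Lemma primitive_direction (x : 'rV[int]_3) : x != 0 -> exists d n w,
  [/\ (0 < n)%N, x = d *+ n & ip d w = 1].
Proof.
move=> x0; pose g1 := gcdz (x 0 i0) (x 0 i1); pose g := gcdz g1 (x 0 i2).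
have [a [b ab]] := Bezoutz (x 0 i0) (x 0 i1); have [c [e ce]] := Bezoutz g1 (x 0 i2).
have gd0 : (g %| (x 0 i0)%R)%Z by apply: dvdz_trans (dvdz_gcdl _ _) (dvdz_gcdl _ _).
have gd1 : (g %| (x 0 i1)%R)%Z by apply: dvdz_trans (dvdz_gcdl _ _) (dvdz_gcdr _ _).
have gd2 : (g %| (x 0 i2)%R)%Z by apply: dvdz_gcdr.
pose d : 'rV[int]_3 := \row_i ((x 0 i)%R %/ g)%Z.
have xE i : x 0 i = d 0 i * g by move: i; apply: ord3_ind; rewrite mxE divzK.
have gn : g = `|g|%N by rewrite /g /gcdz.
have g0 : g != 0.
  by apply: contraNneq x0 => g00; apply/eqP/rowP => i; rewrite xE g00 mulr0 mxE.
exists d, `|g|%N, (\col_i [:: c * a; c * b; e]`_i); split.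
- by rewrite absz_gt0.
- by apply/rowP => i; rewrite -scaler_nat natz -gn [in RHS]mxE mulrC.
rewrite /ip mxE !big_ord_recl big_ord0 addr0.
have -> : (\col_(i < 3) [:: c * a; c * b; e]`_i) i0 0 = c * a by rewrite mxE.
have -> : (\col_(i < 3) [:: c * a; c * b; e]`_i) i1 0 = c * b by rewrite mxE.
have -> : (\col_(i < 3) [:: c * a; c * b; e]`_i) i2 0 = e by rewrite mxE.
apply: (mulIf g0); rewrite mul1r -[RHS]ce /g1 -ab !xE.
move: (d 0 i0) (d 0 i1) (d 0 i2) => y0 y1 y2; ring.
Qed.

Lemma segmentE p q v : segment p q v <->
  exists2 t : rat, 0 <= t <= 1 & v = p + t *: (q - p).
Proof.
have e t : (1 - t) *: p + t *: q = p + t *: (q - p).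
  by rewrite scalerBl scale1r scalerBr addrA addrAC.
by split=> [[t [t01 ->]]|[t t01 ->]]; exists t; rewrite ?e.
Qed.

Lemma segment_left p q : segment p q p.
Proof. by apply/segmentE; exists 0; rewrite ?lexx ?ler01 // scale0r addr0. Qed.

Lemma segmentC p q : segment p q = segment q p.
Proof.
have sub a b v : segment a b v -> segment b a v.
  move=> [t [/andP[t0 t1] ->]]; exists (1 - t); rewrite subr_ge0 t1 gerBl t0.
  by rewrite subKr addrC.
by apply/seteqP; split=> v; apply: sub.
Qed.

Lemma segment_right p q : segment p q q.
Proof. by rewrite segmentC; apply: segment_left. Qed.

Lemma segment_inj a b p q : a != b -> segment p q = segment a b ->
  (p = a /\ q = b) \/ (p = b /\ q = a).
Proof.
move=> ab e; have nz : b - a != 0 by rewrite subr_eq0 eq_sym.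
have := segment_left p q; rewrite e => /segmentE[s /andP[s0 s1] ep].
have := segment_right p q; rewrite e => /segmentE[r /andP[r0 r1] eq].
have qp : q - p = (r - s) *: (b - a) by rewrite ep eq scalerBl; lattice.
have inj t t' : a + t *: (b - a) = a + t' *: (b - a) -> t = t'.
  move=> /addrI /eqP; rewrite -subr_eq0 -scalerBl scaler_eq0 (negbTE nz) orbF subr_eq0.
  by move/eqP.
have param t : p + t *: (q - p) = a + (s + t * (r - s)) *: (b - a).
  by rewrite qp {1}ep scalerA -addrA -scalerDl.
have := segment_left a b; rewrite -e => /segmentE[x /andP[x0 x1]].
have {1}-> : a = a + 0 *: (b - a) by rewrite scale0r addr0.
rewrite param => /inj hx.
have := segment_right a b; rewrite -e => /segmentE[y /andP[y0 y1]].
have {1}-> : b = a + 1 *: (b - a) by rewrite scale1r addrC subrK.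
rewrite param => /inj hy.
have [s00|s00] := eqVneq s 0.
  have r11 : r = 1 by move: hy; rewrite s00; nra.
  by left; rewrite ep eq s00 r11 scale0r scale1r addr0 addrC subrK.
have sp : 0 < s by rewrite lt_neqAle eq_sym s00.
have x11 : x = 1 by nra.
have r00 : r = 0 by move: hx; rewrite x11; lra.
have s11 : s = 1 by move: hy; rewrite r00; nra.
by right; rewrite ep eq r00 s11 scale0r scale1r addr0 addrC subrK.
Qed.

Lemma card_lattice_segment (A d : 'rV[int]_3) n w : ip d w = 1 -> (0 < n)%N ->
  [set v | [/\ segment (toNQ A) (toNQ (A + d *+ n)) v, v != toNQ (A + d *+ n) &
    lattice_point v]] #= `I_n.
Proof.
move=> dw n0.
have dinj : injective (fun m : nat => toNQ (A + d *+ m)).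
  move=> m m' /toNQ_inj /addrI /(congr1 (ip^~ w)); rewrite !ipMnl dw.
  by rewrite !natz => -[].
have E m : toNQ (A + d *+ m) = toNQ A + (m%:R / n%:R) *: (toNQ (A + d *+ n) - toNQ A).
  rewrite !toNQD [toNQ A + toNQ (d *+ n)]addrC addrK !toNQMn -!scaler_nat scalerA divfK //.
  by rewrite pnatr_eq0 -lt0n.
suff -> : [set v | [/\ segment (toNQ A) (toNQ (A + d *+ n)) v, v != toNQ (A + d *+ n) &
    lattice_point v]] = (fun m : nat => toNQ (A + d *+ m)) @` `I_n.
  by apply: inj_card_eq => ? ? _ _ /dinj.
have n0' : 0 < n%:R :> rat by rewrite ltr0n.
apply/seteqP; split=> v /=; last first.
  move=> [m mn <-]; split; last by apply/lattice_pointP; exists (A + d *+ m).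
    apply/segmentE; exists (m%:R / n%:R); last exact: E.
    by rewrite divr_ge0 ?ler0n //= ler_pdivrMr // mul1r ler_nat ltnW.
  by apply/eqP => /dinj e; rewrite e ltnn in mn.
move=> [/segmentE[t /andP[t0 t1] ev] vn /lattice_pointP[z ez]].
(* Pairing with [w] reads off the position on the segment, so a lattice point has an integral
   [t * n]. *)
have tn : t * n%:R = (ip z w - ip A w)%:~R.
  have : pairing v (toMQ w) = (ip A w)%:~R + t * n%:R.
    by rewrite ev pairingDl pairingZl toNQD addrAC subrr add0r !pairing_ip
      ipMnl dw natz -pmulrn.
  by rewrite ez pairing_ip rmorphB /= => ->; rewrite addrAC subrr add0r.
have [m em] : exists m : nat, ip z w - ip A w = m%:Z.
  have : 0 <= ip z w - ip A w by rewrite -(ler0z rat) -tn mulr_ge0 // ltW.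
  by case: (_ - _) => // m _; exists m.
have tE : t = m%:R / n%:R by rewrite -[t](mulfK (lt0r_neq0 n0')) tn em -pmulrn.
have evm : v = toNQ (A + d *+ m) by rewrite E ev tE.
exists m => //; rewrite ltn_neqAle; apply/andP; split.
  by apply: contraNneq vn => e; rewrite evm e.
by have := t1; rewrite tE ler_pdivrMr // mul1r ler_nat.
Qed.

(** [lattice_length] leaves open which endpoint is dropped, so the points are counted for both
    orientations. *)
Lemma lattice_length_segment (A d : 'rV[int]_3) n w l : ip d w = 1 -> (0 < n)%N ->
  lattice_length (segment (toNQ A) (toNQ (A + d *+ n))) l <-> l = n.
Proof.
move=> dw n0; have c1 := card_lattice_segment A dw n0.
have c2 : [set v | [/\ segment (toNQ A) (toNQ (A + d *+ n)) v, v != toNQ A &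
    lattice_point v]] #= `I_n.
  have dw' : ip (- d) (- w) = 1 by rewrite /ip mulNmx mulmxN opprK.
  have := card_lattice_segment (A + d *+ n) dw' n0.
  by rewrite mulNrn addrK segmentC.
have ne : toNQ A != toNQ (A + d *+ n).
  apply/eqP => /toNQ_inj /eqP; rewrite -subr_eq0 opprD addNKr oppr_eq0 => /eqP e.
  have := congr1 (ip^~ w) e; rewrite ipMnl dw /ip mul0mx mxE natz => -[e0].
  by rewrite e0 in n0.
split=> [[p [q [e c]]]|->]; last by exists (toNQ A), (toNQ (A + d *+ n)).
apply/esym/card_eq_II; have [[_ eq]|[_ eq]] := segment_inj ne (esym e); rewrite eq in c.
- by apply: card_eq_trans c; rewrite card_eq_sym.
- by apply: card_eq_trans c; rewrite card_eq_sym.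
Qed.

(** * Exposed faces and dual lattice points *)

Section ConeDuality.
Variables (tau : polycone) (l : seq NQ).
Notation C := (cone tau).
Notation S := (dual_lattice tau).
Hypothesis lC : forall v, C v <-> cone_of l v.
Hypothesis l_extremal : forall v, v \in l -> extremal tau v.

Lemma dual_latticeP u : reflect (forall g, g \in l -> 0 <= pairing g (toMQ u)) (u \in S).
Proof.
apply: (iffP (asboolP _)) => [h g gl|h v]; last exact: (pairing_ge0 lC h).
by apply: h; apply/lC/cone_of_gen.
Qed.

Lemma extremal_in_rays v : extremal tau v -> exists2 t, 0 < t & t *: v \in l.
Proof.
move=> [vC v0 ve]; have /lC[c [c0 ev]] := vC.
have [i ci] : exists i, c i *: l`_i != 0.
  apply: contrapT => h; case/eqP: v0; rewrite ev big1 // => i _.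
  by apply: contrapT => /eqP hi; apply: h; exists i.
have lCi j : C (c j *: l`_j) by apply: coneZ => //; apply/lC/cone_of_gen/mem_nth.
have [|||t t0 e] := ve (c i *: l`_i) (\sum_(j < size l | j != i) c j *: l`_j).
- exact: lCi.
- by elim/big_ind: _ => [|v1 v2|j _]; [exact: cone0|exact: coneD|exact: lCi].
- by rewrite ev [RHS](bigD1 i).
have cn : c i != 0 by apply: contraNneq ci => ->; rewrite scale0r.
have tp : 0 < t.
  by rewrite lt_neqAle t0 andbT eq_sym; apply: contraNneq ci => t00; rewrite e t00 scale0r.
exists ((c i)^-1 * t); first by rewrite mulr_gt0 // invr_gt0 lt_neqAle eq_sym cn c0.
by rewrite -scalerA -e scalerK // mem_nth.
Qed.

(** [f] supports the cone exactly along the face spanned by [ws], which will be the apex, a ray or a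
    two-dimensional face. *)
Definition exposes (f : MQ) (ws : seq NQ) := (forall w, w \in ws -> pairing w f = 0) /\
  forall g, g \in l -> 0 < pairing g f \/ exists t w, [/\ 0 < t, w \in ws & g = t *: w].

Lemma exposes_ge0 f ws : exposes f ws -> forall v, C v -> 0 <= pairing v f.
Proof.
move=> [fw fl]; apply: (pairing_ge0 lC) => g /fl[/ltW//|[t [w [_ /fw e ->]]]].
by rewrite pairingZl e mulr0.
Qed.

Lemma exposed_face f ws v : exposes f ws -> C v -> pairing v f = 0 -> cone_of ws v.
Proof.
move=> fe vC; suff [_] : 0 <= pairing v f /\ (pairing v f = 0 -> cone_of ws v) by apply.
have [fw fl] := fe; move/lC: vC; move: v; apply: cone_of_min.
- by rewrite pairing0l; split=> // _; apply: cone_of0.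
- move=> v w [v0 vf] [w0 wf]; rewrite pairingDl addr_ge0 //; split=> // /eqP.
  by rewrite paddr_eq0 // => /andP[/eqP/vf hv /eqP/wf hw]; apply: cone_ofD.
move=> t v t0 vl; have vC : C v by apply/lC/cone_of_gen.
have v0 := exposes_ge0 fe vC; rewrite pairingZl mulr_ge0 //; split=> // /eqP.
rewrite mulf_eq0 => /orP[/eqP ->|/eqP vf]; first by rewrite scale0r; apply: cone_of0.
have [|[s [w [s0 ww ->]]]] := fl v vl; first by rewrite vf ltxx.
by apply: cone_ofZ => //; apply: cone_ofZ (ltW s0) (cone_of_gen ww).
Qed.

(** A lattice multiple of [f] is positive on the rays off the face, so enough copies of it outweigh
    negative values of [u] there. This supplies the elements required by [facet] and [ridge]. *)
Lemma integral_functional f ws : exposes f ws -> exists f' : Mlat,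
  [/\ f' \in S, forall w, w \in ws -> pairing w (toMQ f') = 0 &
    forall u, (forall w, w \in ws -> 0 <= pairing w (toMQ u)) ->
      exists N, forall M, (N <= M)%N -> u + f' *+ M \in S].
Proof.
move=> fe; have [N [f' [N0 ef]]] := clear_denominators f.
have fC := exposes_ge0 fe; have [fw fl] := fe.
have N0' : 0 < N%:R :> rat by rewrite ltr0n.
exists f'; split=> [|w ww|u uw].
- apply/dual_latticeP => g gl; rewrite ef pairingZr mulr_ge0 ?ler0n // fC //.
  exact/lC/cone_of_gen.
- by rewrite ef pairingZr fw ?mulr0.
have [|B hB] := large_multiple (s := l) (p := fun g => pairing g (toMQ f'))
    (q := fun g => pairing g (toMQ u)).
  move=> g gl; rewrite ef pairingZr; have gC : C g by apply/lC/cone_of_gen.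
  split; first by rewrite mulr_ge0 ?ler0n // fC.
  move/eqP; rewrite mulf_eq0 gt_eqF //= => /eqP g0.
  have [|[t [w [t0 ww ->]]]] := fl g gl; first by rewrite g0 ltxx.
  by rewrite pairingZl mulr_ge0 ?uw // ltW.
exists B => M BM; apply/dual_latticeP => g gl; rewrite pairingD.
have -> : toMQ (f' *+ M) = M%:R *: toMQ f' by rewrite /toMQ raddfMn scaler_nat.
by rewrite pairingZr mulr_natl hB.
Qed.

Lemma interior_exposes : exists f, exposes f [::].
Proof.
have [f hf] := interior_functional l_extremal; exists f; split=> // g gl.
by left; apply: hf.
Qed.

Lemma facet_exposes p w : extremal tau w -> pairing w p = 1 -> exists f, exposes f [:: w].
Proof.
move=> we wp; have [f [fw fl]] := facet_functional l_extremal we wp.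
exists f; split=> [v|g gl]; first by rewrite inE => /eqP ->.
by have [h|[t t0 ->]] := fl g gl; [left|right; exists t, w; rewrite mem_head].
Qed.

Lemma cone_of1 w v : cone_of [:: w] v -> exists2 t, 0 <= t & v = t *: w.
Proof.
move/cone_of_cons => [t [v' [t0 [c [_ ev]] ->]]]; exists t => //.
by rewrite ev big_ord0 addr0.
Qed.

Lemma cone_of2 w w' v : cone_of [:: w; w'] v ->
  exists t t', [/\ 0 <= t, 0 <= t' & v = t *: w + t' *: w'].
Proof.
by move/cone_of_cons => [t [v' [t0 /cone_of1[t' t'0 ->] ->]]]; exists t, t'.
Qed.

Lemma ray_edge p w : extremal tau w -> pairing w p = 1 ->
  exists F, edge C F /\ F w.
Proof.
move=> we wp; have [f fe] := facet_exposes we wp; have [wC w0 _] := we.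
have fw : pairing w f = 0 by case: fe => h _; rewrite h ?mem_head.
exists [set v | C v /\ pairing v f = 0]; split; last by [].
split; first by exists f, 0; split=> // v; apply: exposes_ge0 fe v.
exists 0, w; split=> [|||v [vC vf]].
- by split; [exact: cone0|rewrite pairing0l].
- by [].
- by rewrite eq_sym.
have [t _ ->] := cone_of1 (exposed_face fe vC vf).
by exists t; rewrite subr0 add0r.
Qed.

(** A large multiple of an interior lattice point of the dual cone absorbs finitely many
    translations. *)
Lemma dual_lattice_cofinal (us : seq Mlat) : exists s0, [/\ s0 \in S &
  forall u, u \in us -> u + s0 \in S].
Proof.
have [f fe] := interior_exposes; have [f' [f'S _ f'd]] := integral_functional fe.
have f'N u : exists N, forall M, (N <= M)%N -> u + f' *+ M \in S by apply: f'd.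
have [N hN] : exists N, forall M, (N <= M)%N -> forall u, u \in us -> u + f' *+ M \in S.
  elim: us => [|u us [N hN]]; first by exists 0%N.
  have [N' hN'] := f'N u; exists (maxn N N') => M; rewrite geq_max => /andP[h h'] v.
  by rewrite inE => /orP[/eqP ->|]; [apply: hN'|apply: hN].
have [N0 hN0] := f'N 0; exists (f' *+ maxn N N0); split.
  by rewrite -[f' *+ _]add0r hN0 ?leq_maxr.
by apply: hN; rewrite leq_maxl.
Qed.
End ConeDuality.

(** * The chain of vertices and bounded edges *)

Section VertexChain.
Variables (tau : polycone) (l : seq NQ) (c : NQ) (chi0 : Mlat) (q g : MQ).
Notation C := (cone tau).
Notation S := (dual_lattice tau).
Notation p := (toMQ chi0).
Hypothesis lC : forall v, C v <-> cone_of l v.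
Hypothesis l_extremal : forall v, v \in l -> extremal tau v.
Hypothesis cC : C c.
Hypothesis c0 : c != 0.
Hypothesis cp : pairing c p = 0.
Hypothesis cq : pairing c q = 0.
Hypothesis cg : pairing c g = 1.
Hypothesis sep0 : forall v, pairing v p = 0 -> pairing v q = 0 -> pairing v g = 0 -> v = 0.
Hypothesis p_pos : exists v, C v /\ 0 < pairing v p.
Hypothesis p_lattice : forall F v, edge C F -> F v -> pairing v p = 1 -> lattice_point v.

Definition vertices : seq NQ := sort (relpre (fun v => pairing v q) <=%R)
  (undup [seq (pairing v p)^-1 *: v | v <- l & 0 < pairing v p]).
Definition vert i : NQ := nth 0 vertices i.
Definition last_vert := (size vertices).-1.
Notation k := last_vert.

Lemma verticesP v : v \in vertices <-> vertex tau p v.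
Proof.
rewrite mem_sort mem_undup; split=> [/mapP[w]|[ve vp]].
  rewrite mem_filter => /andP[wp wl] ->; split.
    by apply: extremalZ (l_extremal wl); rewrite invr_gt0.
  by rewrite pairingZl mulVf // gt_eqF.
have [t t0 tl] := extremal_in_rays lC ve; apply/mapP; exists (t *: v).
  by rewrite mem_filter tl pairingZl vp mulr1 t0.
by rewrite pairingZl vp mulr1 scalerK // gt_eqF.
Qed.

Lemma vertices_size : (0 < size vertices)%N.
Proof.
have [v [vC vp]] := p_pos.
have [w wl wp] : exists2 w, w \in l & 0 < pairing w p.
  apply: contrapT => h; have : 0 <= pairing v (- p).
    apply: (pairing_ge0 lC) => // w wl; rewrite pairingNr oppr_ge0 leNgt.
    by apply/negP => wp; apply: h; exists w.
  by rewrite pairingNr oppr_ge0 leNgt vp.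
suff : (pairing w p)^-1 *: w \in vertices by case: vertices.
by rewrite mem_sort mem_undup; apply/mapP; exists w; rewrite // mem_filter wp.
Qed.

Lemma ltn_vertices i : (i < size vertices)%N = (i <= k)%N.
Proof. by rewrite -[in RHS]ltnS /last_vert prednK // vertices_size. Qed.

Lemma vert_vertex i : (i <= k)%N -> vertex tau p (vert i).
Proof.
by move=> ik; apply/verticesP/mem_nth; rewrite ltn_vertices.
Qed.

Lemma vert_cone i : (i <= k)%N -> C (vert i).
Proof. by move/vert_vertex/vertex_cone. Qed.

Lemma vert_p i : (i <= k)%N -> pairing (vert i) p = 1.
Proof. by move/vert_vertex => []. Qed.

Lemma vertex_vert v : vertex tau p v -> exists2 i, (i <= k)%N & v = vert i.
Proof.
move/verticesP => vv; exists (index v vertices); last by rewrite /vert nth_index.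
by rewrite -ltn_vertices index_mem.
Qed.

Lemma vert_lt i j : (i < j)%N -> (j <= k)%N -> pairing (vert i) q < pairing (vert j) q.
Proof.
move=> ij jk; have ik : (i <= k)%N by lia.
have [is_ js] : (i < size vertices)%N /\ (j < size vertices)%N by rewrite !ltn_vertices.
have srt : sorted (relpre (fun v => pairing v q) <=%R) vertices.
  by apply: sort_sorted => v w; apply: le_total.
rewrite lt_neqAle; apply/andP; split.
  apply: contraTneq ij => e.
  have /eqP := vertex_inj cC cp cq cg sep0 (vert_vertex ik) (vert_vertex jk) e.
  by rewrite nth_uniq ?sort_uniq ?undup_uniq // => /eqP ->; rewrite ltnn.
have := @sorted_leq_nth _ _ _ _ 0 vertices srt; apply => //.
- by move=> x y z /= h1 h2; apply: le_trans h1 h2.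
- by move=> x /=.
exact: ltnW.
Qed.

Lemma vert_le i j : (i <= j)%N -> (j <= k)%N -> pairing (vert i) q <= pairing (vert j) q.
Proof. by rewrite leq_eqVlt => /orP[/eqP -> //|ij jk]; apply/ltW/vert_lt. Qed.

Lemma vert_leE i j : (i <= k)%N -> (j <= k)%N ->
  (pairing (vert i) q <= pairing (vert j) q) = (i <= j)%N.
Proof.
move=> ik jk; have [ij|ji] := leqP i j; first exact: vert_le.
by apply/negbTE; rewrite -ltNge vert_lt.
Qed.

Lemma vert_consecutive i v : (i < k)%N -> vertex tau p v ->
  pairing (vert i) q <= pairing v q <= pairing (vert i.+1) q -> v = vert i \/ v = vert i.+1.
Proof.
move=> ik /vertex_vert[j jk ->]; rewrite !vert_leE // ?(ltnW ik) // => ij.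
have : (j == i) || (j == i.+1) by lia.
by case/orP=> /eqP ->; [left|right].
Qed.

(** The ray through a vertex is an edge of the cone, so the integrality assumption on [chi0]
    applies. *)
Lemma vert_lattice i : (i <= k)%N -> lattice_point (vert i).
Proof.
move=> ik; have [ve vp] := vert_vertex ik.
by have [F [eF Fv]] := ray_edge lC l_extremal ve vp; apply: (p_lattice eF Fv).
Qed.

Definition ivert i : 'rV[int]_3 := map_mx Num.floor (vert i).

Lemma ivertE i : (i <= k)%N -> toNQ (ivert i) = vert i.
Proof.
move/vert_lattice => /mxOverP h; apply/matrixP => x y.
by rewrite !mxE floorK // h.
Qed.

Lemma pairing_vert i u : (i <= k)%N -> pairing (vert i) (toMQ u) = (ip (ivert i) u)%:~R.
Proof. by move=> ik; rewrite -ivertE // pairing_ip. Qed.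

Lemma ip_chi0 i : (i <= k)%N -> ip (ivert i) chi0 = 1.
Proof.
move=> ik; have := vert_p ik; rewrite pairing_vert // => /eqP.
by rewrite -(rmorph1 (intr : int -> rat)) eqr_int => /eqP.
Qed.

Lemma ip_ge0 i s : (i <= k)%N -> s \in S -> 0 <= ip (ivert i) s.
Proof.
move=> ik /asboolP sS; rewrite -(ler0z rat) -pairing_vert //.
exact: sS (vert_cone ik).
Qed.

Lemma pairing_le_tail s v t : s \in S -> 0 <= t ->
  pairing v (toMQ s) <= pairing (v + t *: c) (toMQ s).
Proof.
move=> /asboolP sS t0; rewrite pairingDl pairingZl lerDl mulr_ge0 //.
exact: sS.
Qed.

Lemma vert_between i m j : (i < m < j)%N -> (j <= k)%N -> exists s t, [/\ 0 < s < 1, 0 < t &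
  (1 - s) *: vert i + s *: vert j = vert m + t *: c].
Proof.
move=> /andP[im mj] jk.
have him := vert_lt im (leq_trans (ltnW mj) jk); have hmj := vert_lt mj jk.
have dij : 0 < pairing (vert j) q - pairing (vert i) q by rewrite subr_gt0 (lt_trans him).
pose s := (pairing (vert m) q - pairing (vert i) q) / (pairing (vert j) q - pairing (vert i) q).
have s01 : 0 < s < 1.
  apply/andP; rewrite /s; split; first by rewrite divr_gt0 // subr_gt0.
  by rewrite ltr_pdivrMr // mul1r; lra.
have [||||||t t0 e] := @vertex_between tau c p q g cC cp cq cg sep0
  (vert i) (vert m) (vert j) s.
- by apply: vert_vertex; lia.
- by apply: vert_vertex; lia.
- exact: vert_vertex.
- exact: s01.
- by apply: contraTneq him => ->; rewrite ltxx.
- by rewrite /s; field; rewrite gt_eqF.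
by exists s, t.
Qed.

(** Elements of [S] are nonnegative on [c], so the value at [vert m] is at most the value on the
    chord above it, a convex combination of two values below $a$. *)
Lemma ip_between (a : int) i m j s : (i <= m <= j)%N -> (j <= k)%N -> s \in S ->
  ip (ivert i) s < a -> ip (ivert j) s < a -> ip (ivert m) s < a.
Proof.
move=> imj jk sS; have [<- //|im] := eqVneq i m; have [-> //|mj] := eqVneq m j.
have [|x [t [x01 t0 e]]] := @vert_between i m j _ jk; first by lia.
rewrite -!(ltr_int rat) -!pairing_vert //; try lia.
move=> hi hj; apply: le_lt_trans (pairing_le_tail (vert m) sS (ltW t0)) _.
rewrite -e pairingDl !pairingZl; case/andP: x01 => x0 x1; nra.
Qed.

(** Membership is tested on the generators. Where [chi0] is nonpositive, subtracting $a \chi_0$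
    preserves nonnegativity; the other generators are positive multiples of vertices, where [chi0]
    is $1$. *)
Lemma S_outP a s : s \in S ->
  (s - chi0 *+ a \notin S) <-> exists2 i, (i <= k)%N & ip (ivert i) s < a%:Z.
Proof.
move=> sS; have pE v : pairing v (toMQ (s - chi0 *+ a)) =
    pairing v (toMQ s) - a%:R * pairing v p.
  have -> : toMQ (s - chi0 *+ a) = toMQ s - a%:R *: p.
    by rewrite /toMQ raddfB /= raddfMn scaler_nat.
  by rewrite pairingBr pairingZr.
split=> [|[i ik h]]; last first.
  apply/negP => /asboolP /(_ _ (vert_cone ik)); rewrite pE vert_p // pairing_vert // mulr1.
  by rewrite subr_ge0 pmulrn ler_int leNgt h.
move=> /(dual_latticeP lC); have nn := (dual_latticeP lC s) sS.
move=> h; apply: contrapT => nh; apply: h => v vl; rewrite pE subr_ge0.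
have [vp|vp] := lerP (pairing v p) 0.
  by apply: le_trans (nn v vl); rewrite mulr_ge0_le0 ?ler0n.
have [|i ik e] := @vertex_vert ((pairing v p)^-1 *: v).
  split; first by apply: extremalZ (l_extremal vl); rewrite invr_gt0.
  by rewrite pairingZl mulVf // gt_eqF.
have : a%:Z <= ip (ivert i) s by rewrite leNgt; apply/negP => hh; apply: nh; exists i.
by rewrite -(ler_int rat) -pairing_vert // -e pairingZl mulrC ler_pdivlMr.
Qed.

Lemma facet_vert i : (i <= k)%N -> exists f, [/\ f \in S, ip (ivert i) f = 0 &
  forall u, 0 <= ip (ivert i) u -> exists N, u + f *+ N \in S].
Proof.
move=> ik; have [ve vp] := vert_vertex ik.
have [f fe] := facet_exposes l_extremal ve vp.
have [f' [f'S f'0 f'd]] := integral_functional lC fe; exists f'; split=> // [|u u0].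
  apply/eqP; rewrite -(intr_eq0 rat) -pairing_vert // f'0 ?mem_head //.
have [|N hN] := f'd u; last by exists N; apply: hN.
by move=> w; rewrite inE => /eqP ->; rewrite pairing_vert // ler0z.
Qed.

Definition ridge i := ridge_functional p q g (vert i) (vert i.+1).

Lemma ridge_exposes i : (i < k)%N -> exposes l (ridge i) [:: vert i; vert i.+1].
Proof.
move=> ik; have vi := vert_vertex (ltnW ik); have vi1 := vert_vertex ik.
have [h h1] := @ridge_functional_ends tau p q g _ _ vi vi1.
split=> [w|v vl]; first by rewrite !inE => /orP[]/eqP ->.
have [|[t t0 [->|->]]] := ridge_functional_gt0 l_extremal cC cp cq cg sep0 vi vi1
  (vert_lt (ltnSn i) ik) (fun v vv h => vert_consecutive ik vv h) vl; first by left.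
- by right; exists t, (vert i); rewrite mem_head.
- by right; exists t, (vert i.+1); rewrite !inE eqxx orbT.
Qed.

Lemma ridge_vert i : (i < k)%N -> exists f, [/\ f \in S, ip (ivert i) f = 0,
  ip (ivert i.+1) f = 0 & forall u, 0 <= ip (ivert i) u -> 0 <= ip (ivert i.+1) u ->
    exists N, u + f *+ N \in S].
Proof.
move=> ik; have ik' := ltnW ik; have fe := ridge_exposes ik.
have [f' [f'S f'0 f'd]] := integral_functional lC fe; exists f'; split=> // [||u u0 u1].
- by apply/eqP; rewrite -(intr_eq0 rat) -pairing_vert // f'0 ?mem_head.
- by apply/eqP; rewrite -(intr_eq0 rat) -pairing_vert // f'0 // !inE eqxx orbT.
have [|N hN] := f'd u; last by exists N; apply: hN.
by move=> w; rewrite !inE => /orP[]/eqP ->; rewrite pairing_vert // ler0z.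
Qed.

(** * Bounded edges of the slice and their lattice lengths *)

Notation Delta := (slice tau chi0 1).

Lemma segment_edge i : (i < k)%N -> edge Delta (segment (vert i) (vert i.+1)).
Proof.
move=> ik; have ik' := ltnW ik; have fe := ridge_exposes ik; have [fw _] := fe.
split.
  exists (ridge i), 0; split=> [v [vC _]|]; first exact: (exposes_ge0 lC fe vC).
  apply/seteqP; split=> [v [t [/andP[t0 t1] ->]]|v [[vC vp] vf]].
    rewrite /slice /= !pairingDl !pairingZl !vert_p // !fw ?inE ?eqxx ?orbT //.
    rewrite !mulr0 addr0; split=> //; split; last by ring.
    by apply: coneD; apply: coneZ (vert_cone _); rewrite ?subr_ge0.
  have [t [t' [t0 t'0 e]]] := cone_of2 (exposed_face lC fe vC vf).
  move: vp; rewrite e pairingDl !pairingZl !vert_p // !mulr1 => tt.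
  have te : t = 1 - t' by rewrite -tt addrK.
  by exists t'; rewrite te t'0; split=> //; lra.
exists (vert i), (vert i.+1); split; [exact: segment_left|exact: segment_right| |].
  by apply: contraTneq (vert_lt (ltnSn i) ik) => ->; rewrite ltxx.
by move=> v /segmentE[t _ ->]; exists t.
Qed.

Lemma segment_bounded (v w : NQ) : bounded_set (segment v w).
Proof.
exists (\sum_i (`|v 0 i| + `|w 0 i|)) => x [t [/andP[t0 t1] ->]] i.
rewrite (bigD1 i) //= !mxE; apply: (@le_trans _ _ (`|v 0 i| + `|w 0 i|)); last first.
  by rewrite lerDl sumr_ge0 // => j _; apply: addr_ge0.
apply: le_trans (ler_normD _ _) _; rewrite !normrM (ger0_norm t0) ger0_norm ?subr_ge0 //.
by apply: lerD; apply: ler_piMl => //; rewrite gerBl.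
Qed.

(** The slice is the convex hull of its vertices plus its tail cone. Splitting the generators by the
    sign of [p] gives $v = x + y$ with $\langle y, p\rangle \le 0$; the excess height of [x] is then
    moved to [y]. *)
Lemma slice_decomposition v : Delta v -> exists x z,
  [/\ v = x + z, cone_of vertices x, pairing x p = 1, C z & pairing z p = 0].
Proof.
move=> [/lC vl vp].
have sub x : cone_of vertices x -> C x.
  move=> h; apply/lC; move: h; apply: cone_of_sub => w /verticesP/vertex_cone; exact: (lC w).1.
have [x [y [xl yC yp e]]] : exists x y,
    [/\ cone_of vertices x, C y, pairing y p <= 0 & v = x + y].
  move: v vl {vp}; apply: cone_of_min.
  - by exists 0, 0; rewrite addr0 pairing0l; split=> //; [exact: cone_of0|exact: cone0].
  - move=> v w [x [y [xl yC yp ->]]] [x' [y' [xl' yC' yp' ->]]].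
    exists (x + x'), (y + y'); rewrite pairingDl addrACA; split=> //.
    + exact: cone_ofD.
    + exact: coneD.
    + by rewrite -[X in _ <= X]addr0 lerD.
  move=> t w t0 wl; have wC : C w by apply/lC/cone_of_gen.
  have [wp|wp] := ltrP 0 (pairing w p).
    exists (t *: w), 0; rewrite addr0 pairing0l; split=> //; last exact: cone0.
    have -> : t *: w = (t * pairing w p) *: ((pairing w p)^-1 *: w).
      by rewrite scalerA mulfK // gt_eqF.
    apply: cone_ofZ; first by rewrite mulr_ge0 // ltW.
    apply: cone_of_gen; apply/verticesP; split.
      by apply: extremalZ (l_extremal wl); rewrite invr_gt0.
    by rewrite pairingZl mulVf // gt_eqF.
  exists 0, (t *: w); rewrite add0r pairingZl mulr_ge0_le0 //; split=> //.
    exact: cone_of0.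
  exact: coneZ.
have xp : pairing x p = 1 - pairing y p by rewrite -vp e pairingDl addrK.
have xp0 : 0 < pairing x p by rewrite xp; lra.
have xn := lt0r_neq0 xp0.
exists ((pairing x p)^-1 *: x), ((- pairing y p / pairing x p) *: x + y); split.
- rewrite addrA -scalerDl e; congr (_ + _); rewrite -{1}[x]scale1r; congr (_ *: _).
  by rewrite -[1 in LHS](mulfV xn) {1}xp; field.
- by apply: cone_ofZ xl; rewrite invr_ge0 ltW.
- by rewrite pairingZl mulVf.
- apply: coneD yC; apply: coneZ (sub _ xl); rewrite divr_ge0 ?oppr_ge0 //; exact: ltW.
by rewrite pairingDl pairingZl divfK // addNr.
Qed.

(** Boundedness keeps tail directions out of the edge, so its vertices span it. A vertex strictly
    between two of them would put [c] into the tail of the edge, so they are consecutive. *)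
Lemma bounded_edge_segment E : edge Delta E -> bounded_set E ->
  exists2 i, (i < k)%N & E = segment (vert i) (vert i.+1).
Proof.
move=> [[u [d [ud ->]]] [x0 [y0 [[Dx0 fx0] [Dy0 fy0] xy0 _]]]] [bnd hbnd].
(* As [p = 1] on the slice, this makes the supporting condition homogeneous. *)
pose f := u - d *: p.
have fE v : Delta v -> pairing v f = pairing v u - d.
  by move=> [_ vp]; rewrite pairingBr pairingZr vp mulr1.
have f_ge0 v : Delta v -> 0 <= pairing v f by move=> Dv; rewrite fE // subr_ge0 ud.
pose inE' v := Delta v /\ pairing v f = 0.
have EE v : Delta v /\ pairing v u = d <-> inE' v.
  split=> -[Dv h]; split=> //; first by rewrite fE // h subrr.
  by move: h; rewrite fE // => /eqP; rewrite subr_eq0 => /eqP.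
have DeltaD v z t : 0 <= t -> Delta v -> C z -> pairing z p = 0 -> Delta (v + t *: z).
  move=> t0 [vC vp] zC zp; split; first by apply: coneD vC (coneZ t0 zC).
  by rewrite pairingDl pairingZl zp mulr0 addr0.
have tail_ge0 z : C z -> pairing z p = 0 -> 0 <= pairing z f.
  move=> zC zp; rewrite leNgt; apply/negP => zf.
  have t0 : 0 <= (pairing x0 f + 1) / - pairing z f.
    by rewrite divr_ge0 ?addr_ge0 ?f_ge0 // oppr_ge0 ltW.
  have := f_ge0 _ (DeltaD _ _ _ t0 Dx0 zC zp).
  rewrite pairingDl pairingZl invrN mulrN mulNr divfK ?lt_eqF //; lra.
have tail0 v z : inE' v -> C z -> pairing z p = 0 -> pairing z f = 0 -> z = 0.
  move=> [Dv vf] zC zp zf; apply/rowP => i; rewrite [RHS]mxE; apply/eqP/negPn/negP => zi.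
  pose t := (bnd + `|v 0 i| + 1) / `|z 0 i|.
  have b0 : 0 <= bnd by apply: le_trans (hbnd v ((EE v).2 (conj Dv vf)) i).
  have t0 : 0 <= t by rewrite divr_ge0 // !addr_ge0.
  have Et : inE' (v + t *: z).
    by split; [exact: DeltaD|rewrite pairingDl pairingZl vf zf mulr0 addr0].
  have := hbnd _ ((EE _).2 Et) i; rewrite !mxE => hle.
  have : `|t * z 0 i| <= `|v 0 i + t * z 0 i| + `|v 0 i|.
    by rewrite -{1}[t * z 0 i](addKr (v 0 i)) addrC (le_trans (ler_normD _ _)) // normrN.
  rewrite normrM (ger0_norm t0) /t divfK ?normr_eq0 //; lra.
have Dvert i : (i <= k)%N -> Delta (vert i).
  by move=> ik; split; [exact: vert_cone|exact: vert_p].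
pose zeros := [seq w <- vertices | pairing w f == 0].
have Ezeros v : inE' v -> cone_of zeros v.
  move=> [Dv vf]; have [x [z [e xl xp zC zp]]] := slice_decomposition Dv.
  have xC : C x.
    apply/lC; move: xl; apply: cone_of_sub => w /verticesP/vertex_cone; exact: (lC w).1.
  have [xf zf] : pairing x f = 0 /\ pairing z f = 0.
    have fx_ge0 := f_ge0 x (conj xC xp); have fz_ge0 := tail_ge0 z zC zp.
    have /eqP := vf; rewrite e pairingDl paddr_eq0 //.
    by case/andP=> /eqP ? /eqP ?.
  have z0 := tail0 x z (conj (conj xC xp) xf) zC zp zf.
  rewrite e z0 addr0.
  suff [_] : 0 <= pairing x f /\ (pairing x f = 0 -> cone_of zeros x) by apply.
  move: x xl {e xp xC xf}; apply: cone_of_min.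
  - by rewrite pairing0l; split=> // _; exact: cone_of0.
  - move=> x y [x0' xf] [y0' yf]; rewrite pairingDl addr_ge0 //; split=> // /eqP.
    by rewrite paddr_eq0 // => /andP[/eqP/xf hx /eqP/yf hy]; apply: cone_ofD.
  move=> t w t0 wv; have /verticesP [we wp] := wv.
  have wf : 0 <= pairing w f by apply: f_ge0; split=> //; case: we.
  rewrite pairingZl mulr_ge0 //; split=> // /eqP.
  rewrite mulf_eq0 => /orP[/eqP ->|w0]; first by rewrite scale0r; apply: cone_of0.
  by apply: cone_ofZ t0 (cone_of_gen _); rewrite mem_filter w0.
(* With at most one vertex the edge would be a single point. *)
have [w [w' [wz w'z ww']]] : exists w w', [/\ w \in zeros, w' \in zeros & w != w'].
  apply: contrapT => h.
  have [w0 hw0] : exists w0, forall w, w \in zeros -> w = w0.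
    case: zeros h {Ezeros} => [|w0 z] h; first by exists 0.
    exists w0 => w wz; apply: contrapT => /eqP ne; apply: h.
    by exists w, w0; rewrite mem_head.
  have all_w0 v : inE' v -> v = (pairing w0 p)^-1 *: w0.
    move=> Ev; have [t ev] : exists t, v = t *: w0.
      move: (Ezeros v Ev); move: v {Ev}.
      apply: cone_of_min => [|v v' [t ->] [t' ->]|t v _ /hw0 ->].
      - by exists 0; rewrite scale0r.
      - by exists (t + t'); rewrite scalerDl.
      by exists t.
    move: Ev => [[_ +] _]; rewrite ev pairingZl => tw; congr (_ *: _).
    have nz : pairing w0 p != 0 by apply: contraPneq tw => ->; rewrite mulr0; lra.
    by rewrite -[t](mulfK nz) tw mul1r.
  have /EE/all_w0 ex : Delta x0 /\ pairing x0 u = d by [].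
  have /EE/all_w0 ey : Delta y0 /\ pairing y0 u = d by [].
  by rewrite ex ey eqxx in xy0.
have zero_vert m : (m <= k)%N -> (vert m \in zeros) = (pairing (vert m) f == 0).
  by move=> mk; rewrite mem_filter; have /verticesP -> := vert_vertex mk; rewrite andbT.
have adjacent i j : (i < j)%N -> (j <= k)%N -> vert i \in zeros -> vert j \in zeros -> j = i.+1.
  move=> ij jk; rewrite !zero_vert ?(leq_trans (ltnW ij)) // => /eqP fi /eqP fj.
  apply: contrapT => ne; have [|s [t [_ t0 e]]] := @vert_between i i.+1 j _ jk; first by lia.
  have cf : pairing c f = 0.
    have fm : 0 <= pairing (vert i.+1) f by apply/f_ge0/Dvert; lia.
    have := congr1 (pairing^~ f) e; rewrite !(pairingDl, pairingZl) fi fj !mulr0 addr0.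
    move/esym/eqP; rewrite paddr_eq0 //; last by rewrite mulr_ge0 ?tail_ge0 // ltW.
    by move=> /andP[_]; rewrite mulf_eq0 gt_eqF //= => /eqP.
  have ik : (i <= k)%N by lia.
  by case/eqP: c0; apply: (tail0 (vert i)) => //; split; [exact: Dvert|].
have [i [ik zi zi1]] : exists i, [/\ (i < k)%N, vert i \in zeros & vert i.+1 \in zeros].
  have zv v : v \in zeros -> exists2 m, (m <= k)%N & v = vert m.
    by rewrite mem_filter => /andP[_ /verticesP/vertex_vert].
  have [[m mk em] [m' m'k em']] := (zv _ wz, zv _ w'z); rewrite em in wz; rewrite em' in w'z.
  have : m != m' by apply: contraNneq ww' => e; rewrite em em' e.
  rewrite neq_ltn => /orP[h|h].
    by have e := adjacent _ _ h m'k wz w'z; exists m; rewrite -e.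
  by have e := adjacent _ _ h mk w'z wz; exists m'; rewrite -e.
exists i => //; have ik' := ltnW ik.
have [/eqP fi /eqP fi1] : (pairing (vert i) f == 0) /\ (pairing (vert i.+1) f == 0).
  by rewrite -!zero_vert.
apply/seteqP; split=> v; last first.
  move=> [t [/andP[t0 t1] ->]]; apply/EE; split; last first.
    by rewrite pairingDl !pairingZl fi fi1 !mulr0 addr0.
  split; last by rewrite pairingDl !pairingZl !vert_p //; ring.
  by apply: coneD; apply: coneZ (vert_cone _); rewrite ?subr_ge0.
move=> /EE Ev; have vz := Ezeros v Ev; move: Ev => [[_ vp] _].
have /cone_of2[t [t' [t0 t'0 e]]] : cone_of [:: vert i; vert i.+1] v.
  move: vz; apply: cone_of_sub => w'' w''z; apply: cone_of_gen.
  have [m mk em] : exists2 m, (m <= k)%N & w'' = vert m.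
    by move: w''z; rewrite mem_filter => /andP[_ /verticesP/vertex_vert].
  rewrite em !inE; rewrite em in w''z; apply/orP.
  have [mi|mi|->] := ltngtP m i; last by left.
    by have := adjacent _ _ (ltnW mi : (m < i.+1)%N) ik w''z zi1; lia.
  by right; have -> := adjacent _ _ mi mk zi w''z.
move: vp; rewrite e pairingDl !pairingZl !vert_p // !mulr1 => tt.
have te : t = 1 - t' by rewrite -tt addrK.
by exists t'; rewrite te t'0; split=> //; lra.
Qed.

(** [vert i] is the point of the segment with the smallest [q]. *)
Lemma segment_vert_inj i j : (i < k)%N -> (j < k)%N ->
  segment (vert i) (vert i.+1) = segment (vert j) (vert j.+1) -> i = j.
Proof.
have le i' j' : (i' < k)%N -> (j' < k)%N ->
    segment (vert i') (vert i'.+1) = segment (vert j') (vert j'.+1) -> (j' <= i')%N.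
  move=> ik jk e; rewrite -vert_leE ?(ltnW ik) ?(ltnW jk) //.
  have := segment_left (vert i') (vert i'.+1); rewrite e => -[t [/andP[t0 t1] ->]].
  have h := vert_lt (ltnSn j') jk; rewrite pairingDl !pairingZl.
  have : 0 <= t * (pairing (vert j'.+1) q - pairing (vert j') q).
    by rewrite mulr_ge0 // subr_ge0 ltW.
  rewrite mulrBr mulrBl mul1r; lra.
by move=> ik jk e; apply/anti_leq/andP; split; apply: le; rewrite ?e.
Qed.

Lemma edge_directions : exists (dir : nat -> 'rV[int]_3) (len : nat -> nat),
  forall i, (i < k)%N ->
  [/\ ivert i.+1 = ivert i + dir i *+ len i, (0 < len i)%N & exists w, ip (dir i) w = 1].
Proof.
have ex i : exists dn : 'rV[int]_3 * nat, (i < k)%N ->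
    [/\ ivert i.+1 = ivert i + dn.1 *+ dn.2, (0 < dn.2)%N & exists w, ip dn.1 w = 1].
  have [ik|] := ltnP i k; last by exists (0, 0%N).
  have ne : ivert i.+1 - ivert i != 0.
    rewrite subr_eq0; apply: contraTneq (vert_lt (ltnSn i) ik) => e.
    by rewrite -!ivertE ?(ltnW ik) // e ltxx.
  have [d [n [w [n0 e dw]]]] := primitive_direction ne.
  by exists (d, n); split=> //=; [rewrite -e addrC subrK|exists w].
have [dn dnP] := choice ex.
by exists (fun i => (dn i).1), (fun i => (dn i).2).
Qed.

Section EdgeCount.
Variables (dir : nat -> 'rV[int]_3) (len : nat -> nat) (a : nat).
Hypothesis dirP : forall i, (i < k)%N ->
  [/\ ivert i.+1 = ivert i + dir i *+ len i, (0 < len i)%N & exists w, ip (dir i) w = 1].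

Lemma lattice_length_edge i n : (i < k)%N ->
  lattice_length (segment (vert i) (vert i.+1)) n <-> n = len i.
Proof.
move=> ik; have [e n0 [w dw]] := dirP ik.
rewrite -!ivertE ?(ltnW ik) // e; exact: lattice_length_segment dw n0.
Qed.

Lemma card_long_bounded_edges :
  long_bounded_edges Delta a #= `I_(size (long_edges k a len)).
Proof.
pose J r := nth 0%N (long_edges k a len) r.
have JP r : (r < size (long_edges k a len))%N -> (J r < k)%N /\ (a <= len (J r))%N.
  by move=> h; apply: (long_edgesP (Ordinal h)).
suff -> : long_bounded_edges Delta a =
    (fun r => segment (vert (J r)) (vert (J r).+1)) @` `I_(size (long_edges k a len)).
  apply: inj_card_eq => r r'; rewrite !inE /= => hr hr' e.
  have [[rk _] [rk' _]] := (JP r hr, JP r' hr').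
  have /eqP := segment_vert_inj rk rk' e.
  by rewrite nth_uniq ?filter_uniq ?iota_uniq // => /eqP.
apply/seteqP; split=> E /=.
  move=> [Ee Eb [n [En an]]]; have [i ik e] := bounded_edge_segment Ee Eb.
  move: En; rewrite e lattice_length_edge // => en.
  have il : i \in long_edges k a len by rewrite mem_filter mem_iota -en an.
  by exists (index i (long_edges k a len)); rewrite ?index_mem // /J nth_index.
move=> [r /JP[rk ra] <-]; split; [exact: segment_edge|exact: segment_bounded|].
by exists (len (J r)); split=> //; apply/lattice_length_edge.
Qed.

Lemma dim_T1_long_edges (K : fieldType) (X : presentation K tau) : (2 <= a)%N ->
  dim_T1 X (- (chi0 *+ a)) (size (long_edges k a len)).
Proof.
move=> a2.
have dP i : (i < k)%N -> ivert i.+1 - ivert i = dir i *+ len i.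
  by move=> /dirP[-> _ _]; rewrite addrC addKr.
have dprim i : (i < k)%N -> exists w, ip (dir i) w = 1 by case/dirP.
have lgt i : (i < k)%N -> (0 < len i)%N by case/dirP.
have SD s t : s \in S -> t \in S -> s + t \in S by apply: dual_latticeD.
apply: (@dim_T1_partially_additive K tau X _ _ _ _ (fun r =>
   basis_fun K a ivert dir (nth 0%N (long_edges k a len) r))).
(* The list contains $-R$ and all [gdeg i - R], so a single [p0] meets every requirement. *)
- have [p0 [p0S p0d]] := dual_lattice_cofinal lC l_extremal
    (- (chi0 *+ a) :: [seq @gdeg K tau X i - chi0 *+ a | i <- enum 'I_(nvars X)]).
  exists p0; split=> // [|i]; first by rewrite addrC p0d ?mem_head.
  rewrite addrCA addrC p0d // inE; apply/orP; right.
  by apply/mapP; exists i; rewrite ?mem_enum.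
- move=> u; have [s0 [s0S s0d]] := dual_lattice_cofinal lC l_extremal [:: u].
  by exists (u + s0), s0; rewrite addrK s0d ?mem_head.
- move=> r; have [rk ra] := long_edgesP r.
  exact: (basis_fun_additive K (dual_lattice0 tau) SD ip_ge0 a2 (@S_outP a)
    (@ip_between a) dP rk ra).
- move=> G' G'add.
  exact: (partially_additive_decomposition (dual_lattice0 tau) SD ip_chi0 ip_ge0 a2
    (@S_outP a) facet_vert ridge_vert (@ip_between a) dP dprim lgt G'add).
Qed.
End EdgeCount.
End VertexChain.

(** * The count for one slice, and the two signs of the multiple *)

Lemma dim_T1_slice (K : fieldType) (tau : polycone) (X : presentation K tau) (chi0 : Mlat)
    (a : nat) :
  (exists v, cone tau v /\ 0 < pairing v (toMQ chi0)) ->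
  (exists v, cone tau v /\ pairing v (toMQ chi0) < 0) ->
  (forall F v, edge (cone tau) F -> F v -> pairing v (toMQ chi0) = 1 -> lattice_point v) ->
  (2 <= a)%N ->
  exists d, dim_T1 X (- (chi0 *+ a)) d /\ long_bounded_edges (slice tau chi0 1) a #= `I_d.
Proof.
move=> pos [w [wC wp]] lat a2; have [v [vC vp]] := pos.
have [l [lC le]] := extremal_rays tau.
set p := toMQ chi0 in pos wp lat vp.
have vwC : cone tau (pairing v p *: w) by apply: coneZ wC; apply: ltW.
have wvC : cone tau ((- pairing w p) *: v) by apply: coneZ vC; rewrite oppr_ge0 ltW.
(* The weights make [chi0] vanish; pointedness keeps the sum from being zero. *)
pose c := pairing v p *: w + (- pairing w p) *: v.
have cC : cone tau c by apply: coneD.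
have cp : pairing c p = 0 by rewrite pairingDl !pairingZl; ring.
have c0 : c != 0.
  apply/eqP => /(cone_addr0 vwC wvC) /eqP; rewrite scaler_eq0 gt_eqF //= => /eqP w0.
  by rewrite w0 pairing0l ltxx in wp.
have p0 : p != 0.
  by apply: contraTneq vp => ->; rewrite /pairing mulmx0 mxE ltxx.
have [q [g [cq cg sep]]] := coordinates c0 p0 cp.
have [dir [len dirP]] := edge_directions lC le cC c0 cp cq cg sep pos lat.
exists (size (long_edges (last_vert l chi0 q) a len)); split.
  by apply: (@dim_T1_long_edges tau l c chi0 q g) dirP _ _ a2.
by apply: (@card_long_bounded_edges tau l c chi0 q g) dirP.
Qed.

Theorem proposition5p21 (R : realType) (tau : polycone)
    (X : presentation R[i] tau) (chi0 : Mlat)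
    (chi0_prim : primitive chi0)
    (chi0_pos : exists v, cone tau v /\ 0 < pairing v (toMQ chi0))
    (chi0_neg : exists v, cone tau v /\ pairing v (toMQ chi0) < 0)
    (chi0_lattice : forall F v, edge (cone tau) F -> F v ->
       pairing v (toMQ chi0) = 1 \/ pairing v (toMQ chi0) = -1 ->
       lattice_point v)
    (a : nat) (a_ge2 : (2 <= a)%N) :
  (forall chi : Mlat, chi = chi0 *+ a ->
     exists d : nat, dim_T1 X (- chi) d /\
       long_bounded_edges (slice tau chi0 1) a #= `I_d) /\
  (forall chi : Mlat, chi = - (chi0 *+ a) ->
     exists d : nat, dim_T1 X (- chi) d /\
       long_bounded_edges (slice tau chi0 (-1)) a #= `I_d).
Proof.
have lattice1 F v : edge (cone tau) F -> F v ->
    pairing v (toMQ chi0) = 1 -> lattice_point v.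
  by move=> eF Fv e; apply: (chi0_lattice F) => //; left.
have toMQN : toMQ (- chi0) = - toMQ chi0 by rewrite /toMQ raddfN.
split=> chi ->; first exact: dim_T1_slice.
(* The second claim is the first one for [- chi0]. *)
have -> : slice tau chi0 (-1) = slice tau (- chi0) 1.
  apply/seteqP; split=> v [vC e]; split=> //; move: e; rewrite toMQN pairingNr.
    by move=> ->; rewrite opprK.
  by move=> <-; rewrite opprK.
rewrite -mulNrn; apply: dim_T1_slice => //.
- have [v [vC vn]] := chi0_neg; exists v.
  by rewrite toMQN pairingNr oppr_gt0.
- have [v [vC vp]] := chi0_pos; exists v.
  by rewrite toMQN pairingNr oppr_lt0.
move=> F v eF Fv; rewrite toMQN pairingNr => e; apply: (chi0_lattice F) => //.
by right; rewrite -e opprK.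
Qed.
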